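(* As $n\to\infty$, \[ \log N_{\mathbb P}(n)\sim(\log 2)\frac{n}{\log n}. \]
   Context: For an integer $n\ge 1$ let $X_n=\{2,3,\ldots,n+1\}$. A truncated residue profile of length $n$ is a tuple $r=(r_2,\ldots,r_n)$ with $r_k\in\mathbb Z/k\mathbb Z$ for each $2\le k\le n$ (the empty tuple if $n=1$). Its survivor set is \[ S_n(r)=\{m\in X_n:\ m\not\equiv r_k\pmod k\text{ for every } 2\le k<m\}. \] Let $\Pi_n=\{p\in X_n: p\text{ is prime}\}$ and \[ N_{\mathbb P}(n)=\#\{S_n(r)\cap\Pi_n:\ r\text{ a truncated profile of length }n\}, \] the number of distinct intersections of survivor sets with the primes. *)

(* Defs.v *)
From mathcomp Require Import all_boot all_order all_algebra.
Set Implicit Arguments.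
Unset Strict Implicit.
Unset Printing Implicit Defensive.

(* X_n = {2, ..., n + 1}, inside {0, ..., n + 1}. *)
Definition Xset (n : nat) : {set 'I_n.+2} := [set m : 'I_n.+2 | 2 <= m].

(* The moduli 2, ..., n are written k + 2 with k < n - 1, so that r k is the
   residue r_{k+2}. *)
Definition profile (n : nat) := {dffun forall k : 'I_n.-1, 'Z_k.+2}.

Definition survivors (n : nat) (r : profile n) : {set 'I_n.+2} :=
  [set m in Xset n |
    [forall k : 'I_n.-1, (k.+2 < m) ==> ((m : nat)%:R%R != r k)]].

Definition primes_in (n : nat) : {set 'I_n.+2} :=
  [set p in Xset n | prime p].

Definition prime_traces (n : nat) : {set {set 'I_n.+2}} :=
  [set survivors r :&: primes_in n | r : profile n].

Definition NP (n : nat) : nat := #|prime_traces n|.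

(* Main.v *)
Require Import Defs.
From mathcomp Require Import all_boot all_order all_algebra.
From mathcomp Require Import all_classical all_reals all_analysis.
From mathcomp Require Import ring lra zify.
Import Order.TTheory GRing.Theory Num.Theory.
Import numFieldNormedType.Exports.

(* Since NP n <= 2 ^ pi(n+1), and every subset of the primes in ]delta n, n + 1] can
   be removed from the survivors independently, ln (NP n) ~ ln 2 * pi(n), and the
   statement amounts to the prime number theorem.

   To remove exactly a set T of primes p > delta n, fix L ~ 4 / delta and Q = L!, use
   the residue of p modulo p - Q for p in T, and the residue 0 for all other moduli:
   the other numbers p + j (p - Q) = (j + 1) (p - Q) + Q hit by p - Q are divisible
   by j + 1, hence composite.

   The prime number theorem is proved by Selberg's elementary method. Let
   r(x) = psi(x) - x. The Tatuzawa-Iseki identity gives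
   r(x) ln x + sum_(n <= x) Lambda(n) r(x / n) = O(x); iterating it,
   |r(x)| ln^2 x <= 2 sum_(k <= x) ln k |r(x / k)| + O(x ln x).
   If |r(x)| <= a x + O(1), this returns the same bound, with a saving as soon as r(y)
   is small for a positive logarithmic proportion of y. It is: by Mertens' theorem r
   is small somewhere in each [y, K y], and by Selberg's formula r varies slowly, so
   it stays small on a whole interval [m, (1 + e) m]. Hence a can be lowered by a
   fixed amount as long as a >= delta. All arguments are natural numbers, and x / k
   stands for the truncated quotient. *)

(** * Realizable traces on the primes *)

Definition prime_pi N := \sum_(1 <= p < N.+1) prime p.

Lemma card_primes_gt n B :
  #|[set p in primes_in n | B < p]| = \sum_(B.+1 <= p < n.+2) prime p.
Proof.
rewrite -sum1_card.
transitivity (\sum_(i < n.+2 | prime i && (B < i)) 1).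
  apply: eq_bigl => i; rewrite !inE.
  by case pi: (prime i); rewrite ?andbF // prime_gt1.
rewrite -(big_mkord (fun p => prime p && (B < p)) (fun=> 1)) big_mkcond /=.
have [Bn|nB] := leqP B.+1 n.+2; last first.
  rewrite [RHS]big_geq ?(ltnW nB) // big_nat big1 // => i /andP[_ iN].
  by case: ifP => // /andP[_ Bi]; lia.
rewrite (big_cat_nat (n := B.+1)) //= big_nat big1 ?add0n; last first.
  by move=> i /andP[_ iB]; rewrite ltnNge -ltnS iB andbF.
by apply: eq_big_nat => i /andP[Bi _]; rewrite Bi andbT; case: prime.
Qed.

Lemma card_primes_in n : #|primes_in n| = prime_pi n.+1.
Proof.
rewrite /prime_pi -card_primes_gt; apply: eq_card => p; rewrite !inE.
by case: ltnP => //= h; rewrite (ltnW h) andbT.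
Qed.

Lemma NP_le n : NP n <= 2 ^ prime_pi n.+1.
Proof.
rewrite -card_primes_in -card_powerset; apply: subset_leq_card.
by apply/fintype.subsetP => _ /imsetP[r _ ->]; rewrite powersetE subsetIr.
Qed.

Lemma eq_natr_Z k (a b : nat) :
  ((a%:R : 'Z_k.+2) == b%:R)%R = (a == b %[mod k.+2]).
Proof. by rewrite -val_eqE /= !val_Zp_nat. Qed.

(* Modulus [K = p - Q] with residue [Q] kills the numbers [q * K + Q]; the prime [p]
   is the case [q = 1], and for [1 < q <= L] the number is divisible by [q], since
   [Q] is. *)
Lemma prime_trace_exists n L B (T : {set 'I_n.+2}) :
  2 * L`! <= B -> 2 * n.+1 <= L * B -> T \subset [set p in primes_in n | B < p] ->
  primes_in n :\: T \in prime_traces n.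
Proof.
set Q := L`! => QB LB /fintype.subsetP TB.
have Q0 : 0 < Q by exact: fact_gt0.
have n1 p : p \in T -> [/\ prime p, B < p & p < n.+2].
  by move/TB; rewrite !inE => /andP[/andP[_ ->] ->].
pose r : profile n := [ffun k : 'I_n.-1 =>
  (if [exists p in T, p == (k.+2 + Q)%N :> nat] then Q%:R else 0)%R].
apply/imsetP; exists r => //; apply/setP => m; rewrite !inE.
case pm: (prime m); rewrite ?andbF // prime_gt1 //= !andbT.
apply/idP/fintype.forallP => [mT k|alive].
  apply/implyP => km; rewrite ffunE; case: ifPn => [/exists_inP[p pT /eqP pE]|_].
    have [pp Bp pn] := n1 p pT; rewrite eq_natr_Z.
    have QK : Q < k.+2 by lia.
    have KB : B < 2 * k.+2 by lia.
    rewrite (modn_small QK); apply/negP => /eqP mQ.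
    have mE := divn_eq m k.+2; rewrite mQ in mE.
    set q := m %/ k.+2 in mE.
    have q0 : 0 < q by rewrite divn_gt0 // ltnW.
    have [q1|q1] := leqP q 1.
      have q1' : q = 1 by lia.
      case/negP: mT; suff -> : m = p by [].
      by apply: val_inj; rewrite /= pE mE q1' mul1n.
    have mn := ltn_ord m.
    (* As [p > B >= 2 Q], the modulus satisfies [2 k.+2 > B]; hence [q > L] would give
       [2 m > L B >= 2 (n + 1)]. *)
    have qL : q <= L.
      rewrite leqNgt; apply/negP => Lq.
      have : L * B <= q * (2 * k.+2) by apply: leq_mul; apply: ltnW.
      lia.
    have qm : q %| m by rewrite mE dvdn_add // ?dvdn_mulr // dvdn_fact // q0.
    have /primeP[_ /(_ q qm)] := pm.
    rewrite (gtn_eqF q1) /= => /eqP qm'.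
    have : q * 2 <= q * k.+2 by rewrite leq_mul2l orbT.
    by lia.
  rewrite -[0%R]/(0%:R)%R eq_natr_Z mod0n; apply/negP => km'.
  have /primeP[_ /(_ k.+2 km')] := pm.
  by rewrite (ltn_eqF km).
(* A prime [m] of [T] is killed by the modulus [m - Q], in range since [0 < Q] and
   [2 Q <= B < m]. *)
apply/negP => mT; have [_ Bm mn] := n1 m mT.
have kn : m - Q - 2 < n.-1 by lia.
pose k := Ordinal kn; have kE : k.+2 = m - Q by rewrite /=; lia.
have rk : r k = Q%:R%R.
  rewrite ffunE ifT //; apply/exists_inP; exists m => //.
  by rewrite kE subnK //; lia.
have := alive k; rewrite rk eq_natr_Z kE (_ : m - Q < m) /=; last by lia.
by rewrite -{1}(@subnK Q m) ?modnDl ?eqxx //; lia.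
Qed.

(** Complementation in [primes_in n] is injective on the subsets of [P], the primes above [B], and
    each complement is a trace by [prime_trace_exists]. *)
Lemma NP_ge n L B : 2 * L`! <= B -> 2 * n.+1 <= L * B ->
  2 ^ (prime_pi n.+1 - prime_pi B) <= NP n.
Proof.
move=> QB LB; pose P := [set p in primes_in n | B < p].
apply: (@leq_trans (2 ^ #|P|)).
  rewrite leq_exp2l // card_primes_gt /prime_pi leq_subLR.
  have [Bn|nB] := leqP B.+1 n.+2; first by rewrite [leqLHS](big_cat_nat (n := B.+1)).
  (* Here [B > n + 1], so [prime_pi B] alone is large enough. *)
  apply: leq_trans (leq_addr _ _).
  by rewrite [leqRHS](big_cat_nat (n := n.+2)) ?leq_addr // ltnW.
have PP : P \subset primes_in n by apply/fintype.subsetP => p; rewrite !inE => /andP[].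
have K (T : {set 'I_n.+2}) : T \subset P -> primes_in n :\: (primes_in n :\: T) = T.
  by move=> TP; rewrite finset.setDDr finset.setDv finset.set0U;
     apply/finset.setIidPr; apply: fintype.subset_trans TP PP.
have inj : {in powerset P &, injective (fun T => primes_in n :\: T)}.
  by move=> T1 T2; rewrite !powersetE => h1 h2 E; rewrite -(K T1) // E K.
rewrite -card_powerset -(card_in_imset inj).
apply: subset_leq_card; apply/fintype.subsetP => _ /imsetP[T TP ->].
by rewrite powersetE in TP; exact: (@prime_trace_exists n L B T QB LB TP).
Qed.

Local Open Scope classical_set_scope.
Local Open Scope ring_scope.

(** * Logarithmic sums *)

Section LogSums.
Context {R : realType}.
Implicit Types (n m x k d : nat).

Lemma ln_nat_ge0 n : 0 <= ln (n%:R : R).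
Proof.
by case: n => [|n]; [rewrite ln0 | apply: ln_ge0; rewrite ler1n].
Qed.

Lemma ler_ln_nat m n : (0 < m)%N -> (m <= n)%N -> ln (m%:R : R) <= ln n%:R.
Proof.
move=> m0 mn; rewrite ler_ln ?posrE ?ltr0n ?ler_nat //.
exact: leq_trans mn.
Qed.

Lemma ln_natM m n : (0 < m)%N -> (0 < n)%N ->
  ln ((m * n)%:R : R) = ln m%:R + ln n%:R.
Proof. by move=> m0 n0; rewrite natrM lnM ?posrE ?ltr0n. Qed.

Lemma ln_subl_le (a b : R) : 0 < a -> 0 < b -> ln a - ln b <= (a - b) / b.
Proof.
move=> a0 b0; rewrite -ln_div ?posrE //.
have -> : a / b = 1 + (a - b) / b by field; rewrite gt_eqF.
apply: le_ln1Dx.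
have : 0 < a / b by rewrite divr_gt0.
have -> : (a - b) / b = a / b - 1 by field; rewrite gt_eqF.
lra.
Qed.

Lemma ln_succ_le n : (0 < n)%N -> ln (n.+1%:R : R) - ln n%:R <= n%:R^-1.
Proof.
move=> n0; apply: le_trans (ln_subl_le _ _ _ _) _; rewrite ?ltr0n //.
by rewrite -natr1 addrAC subrr add0r mul1r.
Qed.

Lemma ln_succ_ge n : (0 < n)%N -> n.+1%:R^-1 <= ln (n.+1%:R : R) - ln n%:R.
Proof.
move=> n0; rewrite -lerN2 opprB.
apply: le_trans (ln_subl_le _ _ _ _) _; rewrite ?ltr0n //.
rewrite -natr1 opprD addrA subrr add0r mulN1r //.
Qed.

Lemma sum_ln_ge x :
  x%:R * ln x%:R - x%:R <= \sum_(1 <= n < x.+1) ln (n%:R : R).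
Proof.
elim: x => [|x IH]; first by rewrite big_geq // mul0r subr0.
rewrite big_nat_recr //=.
case: x IH => [|x] IH.
  by rewrite big_geq // ln1 mulr0; lra.
have h := ln_succ_le x.+1 isT.
have hx : (0 : R) < x.+1%:R by rewrite ltr0n.
have : x.+1%:R * (ln x.+2%:R - ln x.+1%:R) <= (1 : R).
  by rewrite mulrC -ler_pdivlMr // div1r.
move: IH; rewrite -(natr1 x.+1).
lra.
Qed.

Lemma sum_ln_le x : (0 < x)%N ->
  \sum_(1 <= n < x.+1) ln (n%:R : R) <= x%:R * ln x%:R - x%:R + 1 + ln x%:R.
Proof.
elim: x => [//|x IH _].
rewrite big_nat_recr //=.
case: x IH => [|x] IH.
  by rewrite big_geq // ln1 mulr0; lra.
have {IH} := IH isT.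
have h := ln_succ_ge x.+1 isT.
have hx : (0 : R) < x.+2%:R by rewrite ltr0n.
have : 1 <= x.+2%:R * (ln x.+2%:R - ln x.+1%:R) :> R.
  by rewrite mulrC -ler_pdivrMr // div1r.
rewrite -(natr1 x.+1).
lra.
Qed.

Definition harm x : R := \sum_(1 <= n < x.+1) n%:R^-1.

Lemma harmS x : harm x.+1 = harm x + x.+1%:R^-1.
Proof. by rewrite /harm big_nat_recr. Qed.

(* [harm - ln] decreases and [harm - ln (_ + 1)] increases, so the former is
   within [1 / m] of its value at any later point. *)
Lemma harm_sub_ln m x : (0 < m <= x)%N ->
  harm x - ln x%:R <= harm m - ln m%:R <= harm x - ln x%:R + m%:R^-1.
Proof.
move=> /andP[m0]; elim: x => [|x IH]; first by case: m m0.
rewrite leq_eqVlt => /orP[/eqP <-|].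
  by rewrite lexx lerDl invr_ge0 ler0n.
rewrite ltnS => mx; have x0 : (0 < x)%N by exact: leq_trans mx.
have /andP[IH1 IH2] := IH mx.
apply/andP; split.
  apply: le_trans IH1; rewrite harmS.
  have := ln_succ_ge x x0; set t := _^-1; lra.
have incr y : (m <= y)%N -> harm m - ln m.+1%:R <= harm y - ln y.+1%:R.
  elim: y => [|y IHy]; first by rewrite leqn0 => /eqP m00; rewrite m00 in m0.
  rewrite leq_eqVlt => /orP[/eqP -> //|]; rewrite ltnS => my.
  apply: le_trans (IHy my) _; rewrite harmS.
  have := ln_succ_le y.+1 isT; set t := _^-1; lra.
have := incr x.+1 (leqW mx); have := ln_succ_le m m0.
have : ln (x.+1%:R : R) <= ln x.+2%:R by apply: ler_ln_nat.
lra.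
Qed.

Lemma harm_ge x : (0 < x)%N -> ln x%:R <= harm x.
Proof.
move=> x0.
have incr y : (0 < y)%N -> ln y.+1%:R <= harm y.
  elim: y => [//|y IHy] _; rewrite harmS.
  have := ln_succ_le y.+1 isT.
  case: y IHy => [|y] IHy; first by rewrite /harm big_geq // ln1 invr1; lra.
  have := IHy isT; set t := _^-1; lra.
by apply: le_trans (incr _ x0); apply: ler_ln_nat.
Qed.

Lemma harm_le x : (0 < x)%N -> harm x <= ln x%:R + 1.
Proof.
move=> x0; have /andP[h _] := @harm_sub_ln 1 x x0.
by move: h; rewrite /harm big_nat1 ln1 invr1; lra.
Qed.

(** Raising [x] by one adds some [D <= 1 / x] to every logarithm; as the logarithms sum to at most
    [x], the squares gain at most 3. *)
Lemma sum_sqr_ln_ratio x :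
  \sum_(1 <= n < x.+1) (ln x%:R - ln n%:R) ^+ 2 <= 3 * x%:R :> R.
Proof.
elim: x => [|x IH]; first by rewrite big_geq // mulr0.
case: x IH => [|x] IH; first by rewrite big_nat1 subrr expr0n /=; lra.
rewrite big_nat_recr //= subrr expr0n addr0.
set D : R := ln x.+2%:R - ln x.+1%:R.
have D0 : 0 <= D by rewrite subr_ge0 ler_ln_nat.
have Dx : x.+1%:R * D <= 1.
  by rewrite mulrC -ler_pdivlMr ?ltr0n // div1r ln_succ_le.
rewrite (eq_bigr (fun n => (ln x.+1%:R - ln n%:R) ^+ 2 + 
    (2 * D * (ln x.+1%:R - ln n%:R) + D ^+ 2))); last first.
  by move=> n _; rewrite /D; ring.
rewrite big_split big_split /= -mulr_sumr sumrB !sumr_const_nat subn1 /=.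
rewrite -[ln _ *+ _]mulr_natr -[D ^+ 2 *+ _]mulr_natr.
have := sum_ln_ge x.+1; set S := \sum_(_ <= _ < _) ln _.
rewrite -(natr1 x.+1).
have x1 : (1 : R) <= x.+1%:R by rewrite ler1n.
set X : R := x.+1%:R in Dx x1 IH * => hS.
have : D * (ln X * X - S) <= D * X by apply: ler_wpM2l => //; lra.
have : D ^+ 2 * X <= D * 1 by rewrite expr2 -mulrA ler_wpM2l // mulrC.
have : D <= X * D by rewrite ler_peMl.
lra.
Qed.

End LogSums.

(** * The von Mangoldt and Moebius functions *)

Section DivisorSums.
Context {V : zmodType}.

(** Both sides run over the pairs with [d * m <= x], the left one grouped by the product. From [x]
    to [x + 1], the range of [m] grows exactly for the divisors [d] of [x + 1]. *)
Lemma sum_divisors_swap (h : nat -> nat -> V) x :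
  \sum_(1 <= n < x.+1) \sum_(1 <= d < n.+1 | (d %| n)%N) h d (n %/ d)%N =
  \sum_(1 <= d < x.+1) \sum_(1 <= m < (x %/ d).+1) h d m.
Proof.
elim: x => [|x IH]; first by rewrite !big_geq.
rewrite big_nat_recr //= IH [RHS]big_nat_recr //= divnn /= big_nat1.
rewrite [X in _ + X]big_mkcond big_nat_recr //= dvdnn divnn /= addrA.
congr (_ + _); rewrite -big_split /=.
apply: eq_big_nat => d /andP[d0 _]; rewrite divnS //.
case: (d %| x.+1)%N; last by rewrite addr0.
by rewrite !add1n [RHS]big_nat_recr.
Qed.

Lemma sum_divisors_widen (F : nat -> V) n N : (0 < n <= N)%N ->
  \sum_(1 <= d < N.+1 | (d %| n)%N) F d = \sum_(1 <= d < n.+1 | (d %| n)%N) F d.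
Proof.
move=> /andP[n0 nN]; rewrite (big_cat_nat (n := n.+1)) //= [X in _ + X]big1_seq ?addr0 //.
move=> d /andP[dn]; rewrite mem_index_iota => /andP[nd _].
by have := dvdn_leq n0 dn; rewrite leqNgt nd.
Qed.

Lemma sum_multiples (F : nat -> V) p N : (0 < p)%N ->
  \sum_(1 <= d < N.+1 | (p %| d)%N) F d = \sum_(1 <= e < (N %/ p).+1) F (p * e)%N.
Proof.
move=> p0; elim: N => [|N IH]; first by rewrite div0n !big_geq.
rewrite big_mkcond big_nat_recr //= -big_mkcond IH divnS //.
case: ifP => [pN|_]; last by rewrite addr0.
rewrite add1n [RHS]big_nat_recr //=; congr (_ + F _).
by have := divnK pN; rewrite divnS // pN add1n mulnC => ->.
Qed.

End DivisorSums.

(** * Moebius inversion and the Tatuzawa-Iseki identity *)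

Section Arithmetic.
Context {R : realType}.
Implicit Types (n m x k d e p : nat).

(** A prime power is recognized by its list of prime divisors being a singleton. *)
Definition mangoldt n : R := if primes n is [:: p] then ln p%:R else 0.

Lemma mangoldt_ge0 n : 0 <= mangoldt n.
Proof. by rewrite /mangoldt; case: primes => [|p []] // *; exact: ln_nat_ge0. Qed.

Lemma mangoldt1 : mangoldt 1 = 0.
Proof. by []. Qed.

Lemma mangoldtX p e : prime p -> mangoldt (p ^ e.+1) = ln p%:R.
Proof. by move=> pp; rewrite /mangoldt primesX // primes_prime. Qed.

Lemma mangoldt_neq0P n : mangoldt n != 0 -> exists p e, prime p /\ n = (p ^ e.+1)%N.
Proof.
rewrite /mangoldt; case E: primes => [|p [|q s]]; rewrite ?eqxx // => _.
have : p \in primes n by rewrite E mem_head.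
rewrite mem_primes => /and3P[pp n0 pn]; exists p.
have /p_natP[k nk] : (p.-nat n)%N by rewrite /pnat n0 E /= inE eqxx.
case: k nk => [|k] nk; last by exists k.
by move: E; rewrite nk expn0.
Qed.

(** Induction along [n = p * m] with [p] prime. Among the divisors of [n] that do not divide [m],
    the only prime power is [p ^ a.+1] with [a = logn p m]; it contributes [ln p]. *)
Lemma sum_mangoldt n : (0 < n)%N ->
  \sum_(1 <= d < n.+1 | (d %| n)%N) mangoldt d = ln n%:R.
Proof.
elim/ltn_ind: n => n IH n0.
have [n1|n1] := leqP n 1.
  have -> : n = 1%N by apply/eqP; rewrite eqn_leq n1.
  by rewrite big_mkcond big_nat1 dvdnn mangoldt1 ln1.
have pp := pdiv_prime n1; set p := pdiv n in pp.
have pn : (p %| n)%N := pdiv_dvd n.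
set m := (n %/ p)%N; have nE : n = (p * m)%N by rewrite mulnC divnK.
have m0 : (0 < m)%N by move: n0; rewrite nE muln_gt0 => /andP[].
have mn : (m < n)%N by rewrite ltn_Pdiv ?prime_gt1.
rewrite (bigID (fun d => (d %| m)%N)) /=.
rewrite (eq_bigl (fun d => (d %| m)%N)); last first.
  by move=> d; rewrite /= nE; apply/andb_idl => h; rewrite dvdn_mull.
rewrite sum_divisors_widen ?m0 ?(ltnW mn) // IH //.
have -> : ln (n%:R : R) = ln p%:R + ln m%:R by rewrite {1}nE ln_natM // prime_gt0.
rewrite addrC; congr (_ + _).
set a := logn p m; have d0n : (p ^ a.+1 %| n)%N.
  by rewrite nE expnS dvdn_pmul2l ?prime_gt0 // pfactor_dvdnn.
have d0m : ~~ (p ^ a.+1 %| m)%N by rewrite pfactor_dvdn // ltnn.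
rewrite big_mkcond (bigD1_seq (p ^ a.+1)%N) ?iota_uniq //=; last first.
  by rewrite mem_index_iota expn_gt0 prime_gt0 //= ltnS dvdn_leq.
rewrite d0n d0m mangoldtX // big1 ?addr0 // => d dd0; case: ifP => // /andP[dn dm].
apply/eqP; apply: contraTT dd0 => /mangoldt_neq0P[q [e [pq dE]]].
rewrite negbK; have [qp|qp] := eqVneq q p.
  rewrite dE qp in dn dm *; rewrite nE expnS dvdn_pmul2l ?prime_gt0 // in dn.
  rewrite pfactor_dvdn // in dn; rewrite pfactor_dvdn // -ltnNge ltnS in dm.
  by rewrite -/a in dn dm; rewrite (_ : e = a) //; apply/eqP; rewrite eqn_leq dn.
move: dm; rewrite dE => /negP[]; move: dn; rewrite dE nE Gauss_dvdr //.
by rewrite coprimeXl // prime_coprime // dvdn_prime2.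
Qed.

(** The test on [logn] expresses that [n] is squarefree. *)
Definition moebius n : R :=
  if all (fun p => logn p n == 1%N) (primes n) then (-1) ^+ size (primes n) else 0.

Lemma normr_moebius_le1 n : `|moebius n| <= 1.
Proof.
by rewrite /moebius; case: ifP => _; rewrite ?normr0 // normrX normrN1 expr1n.
Qed.

Lemma moebius_mul_prime p e : prime p -> (0 < e)%N ->
  moebius (p * e) = if (p %| e)%N then 0 else - moebius e.
Proof.
move=> pp e0; have p0 := prime_gt0 pp; rewrite /moebius.
have [pe|pe] := boolP (p %| e)%N.
  case: ifP => // al; have := allP al p.
  rewrite mem_primes pp muln_gt0 p0 e0 dvdn_mulr //= => /(_ isT).
  have : (0 < logn p e)%N by rewrite logn_gt0 mem_primes pp e0 pe.
  by rewrite lognM // (logn_prime _ pp) eqxx add1n eqSS; case: logn.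
have hp : perm_eq (primes (p * e)) (p :: primes e).
  apply: uniq_perm; rewrite ?primes_uniq //=.
    by rewrite primes_uniq mem_primes (negbTE pe) !andbF.
  by move=> q; rewrite primesM // !inE primes_prime // inE.
rewrite (perm_all _ hp) (perm_size hp) /= exprS mulN1r.
rewrite lognM // (logn_prime _ pp) eqxx lognE pp e0 (negbTE pe) addn0 /=.
rewrite (@eq_in_all _ _ (fun p => logn p e == 1%N)); last first.
  move=> q; rewrite mem_primes => /and3P[pq _ qe] /=.
  rewrite lognM // (logn_prime _ pp); case: (eqVneq q p) => // qp.
  by rewrite -qp qe in pe.
by case: ifP; rewrite // oppr0.
Qed.

(** With [n = p * m], the divisors [p * e] contribute [- moebius e] when [p] does not divide [e] and
    0 otherwise, which cancels the divisors prime to [p]. *)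
Lemma sum_moebius n : (0 < n)%N ->
  \sum_(1 <= d < n.+1 | (d %| n)%N) moebius d = (n == 1)%:R.
Proof.
move=> n0; have [n1|n1] := leqP n 1.
  have -> : n = 1%N by apply/eqP; rewrite eqn_leq n1.
  by rewrite big_mkcond big_nat1 dvdnn eqxx.
have pp := pdiv_prime n1; set p := pdiv n in pp.
have p0 := prime_gt0 pp.
have pn : (p %| n)%N := pdiv_dvd n.
set m := (n %/ p)%N; have nE : n = (p * m)%N by rewrite mulnC divnK.
have m0 : (0 < m)%N by move: n0; rewrite nE muln_gt0 => /andP[].
have mn : (m < n)%N by rewrite ltn_Pdiv ?prime_gt1.
rewrite (bigID (fun d => (p %| d)%N)) /= gtn_eqF //.
rewrite (eq_bigl (fun d => (p %| d)%N && (d %| n)%N)); last by move=> d; rewrite andbC.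
rewrite big_mkcondr sum_multiples // -/m.
rewrite (@eq_big_nat _ _ _ _ _ _
  (fun e => if (e %| m)%N && ~~ (p %| e)%N then - moebius e else 0)); last first.
  move=> e /andP[e0 _]; rewrite nE dvdn_pmul2l // moebius_mul_prime //.
  by case: (e %| m)%N; case: (p %| e)%N.
rewrite -big_mkcond /= sumrN addrC; apply/eqP; rewrite subr_eq0; apply/eqP.
rewrite big_mkcondr (bigID (fun d => (d %| m)%N)) /= [X in _ + X]big1 ?addr0; last first.
  move=> d /andP[dn dm]; case: ifP => // pd; case/negP: dm.
  by rewrite nE Gauss_dvdr // in dn; rewrite coprime_sym prime_coprime // pd.
rewrite (eq_bigl (fun d => (d %| m)%N)); last first.
  by move=> d; rewrite /= nE; apply/andb_idl => h; rewrite dvdn_mull.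
by rewrite sum_divisors_widen ?m0 ?(ltnW mn) // -big_mkcondr.
Qed.

(** Moebius inversion of [sum_mangoldt] gives [H1]; the part with [ln n] drops out by [sum_moebius],
    which is [H2]. *)
Lemma sum_moebius_ln n : (0 < n)%N ->
  \sum_(1 <= d < n.+1 | (d %| n)%N) moebius d * ln d%:R = - mangoldt n.
Proof.
move=> n0.
have H1 : \sum_(1 <= d < n.+1 | (d %| n)%N) moebius d * (ln n%:R - ln d%:R) = mangoldt n.
  transitivity (\sum_(1 <= d < n.+1) \sum_(1 <= e < n.+1)
      (if (d * e %| n)%N then moebius d * mangoldt e else 0)).
    rewrite big_mkcond /=; apply: eq_big_nat => d /andP[d0 _].
    case: ifP => dn; last first.
      rewrite big1 // => e _; case: ifP => // den.
      by rewrite (dvdn_trans (dvdn_mulr e (dvdnn d)) den) in dn.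
    have nE : n = (d * (n %/ d))%N by rewrite mulnC divnK.
    have nd0 : (0 < n %/ d)%N by rewrite divn_gt0 // dvdn_leq.
    have -> : ln (n%:R : R) - ln d%:R = ln (n %/ d)%:R.
      by rewrite {1}nE ln_natM // addrAC subrr add0r.
    rewrite -sum_mangoldt // -(@sum_divisors_widen _ _ _ n) ?nd0 ?leq_div //.
    rewrite mulr_sumr -big_mkcond; apply: eq_bigl => e.
    by rewrite {2}nE dvdn_pmul2l.
  rewrite exchange_big /=.
  transitivity (\sum_(1 <= e < n.+1) (if e == n then mangoldt e else 0)); last first.
    by rewrite big_nat_recr //= eqxx big1_seq ?add0r // => e /andP[_];
       rewrite mem_index_iota => /andP[_ en]; rewrite ltn_eqF.
  apply: eq_big_nat => e /andP[e0 _].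
  have [en|en] := boolP (e %| n)%N; last first.
    rewrite big1; first by case: eqVneq en => // ->; rewrite dvdnn.
    move=> d _; case: ifP => // den.
    by rewrite (dvdn_trans (dvdn_mull d (dvdnn e)) den) in en.
  have nE : n = ((n %/ e) * e)%N by rewrite divnK.
  have nd0 : (0 < n %/ e)%N by rewrite divn_gt0 // dvdn_leq.
  transitivity (\sum_(1 <= d < n.+1 | (d %| n %/ e)%N) moebius d * mangoldt e).
    rewrite [RHS]big_mkcond; apply: eq_bigr => d _.
    by rewrite {1}nE dvdn_pmul2r.
  rewrite -mulr_suml sum_divisors_widen ?nd0 ?leq_div // sum_moebius //.
  have -> : (n %/ e == 1)%N = (e == n).
    by rewrite eq_sym eqn_div // mul1n.
  by case: eqP; rewrite ?mul1r ?mul0r.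
have H2 : \sum_(1 <= d < n.+1 | (d %| n)%N) moebius d * ln n%:R = 0.
  rewrite -mulr_suml sum_moebius //; case: eqP => [->|_]; last by rewrite mul0r.
  by rewrite ln1 mulr0.
rewrite -H1 -sumrN; apply/eqP; rewrite -subr_eq0 -sumrB -[X in _ == X]H2; apply/eqP.
by apply: eq_bigr => d _; ring.
Qed.

(** Grouping by the product, the coefficient of [F n] is the sum of [moebius d * (ln x - ln d)] over
    the divisors of [n]: [mangoldt n], plus [ln x] if [n = 1]. *)
Lemma tatuzawa_iseki (F : nat -> R) x : (0 < x)%N ->
  \sum_(1 <= d < x.+1) moebius d * (ln x%:R - ln d%:R) *
     \sum_(1 <= n < (x %/ d).+1) F (d * n)%N
  = F 1%N * ln x%:R + \sum_(1 <= k < x.+1) mangoldt k * F k.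
Proof.
move=> x0.
under eq_bigr do rewrite mulr_sumr.
rewrite -(sum_divisors_swap (fun d n => moebius d * (ln x%:R - ln d%:R) * F (d * n)%N)).
transitivity (\sum_(1 <= n < x.+1)
  ((if n == 1%N then F 1%N * ln x%:R else 0) + mangoldt n * F n)).
  apply: eq_big_nat => n /andP[n0 _].
  transitivity (\sum_(1 <= d < n.+1 | (d %| n)%N) 
       (moebius d * (ln x%:R * F n) - (moebius d * ln d%:R) * F n)).
    apply: eq_bigr => d dn; rewrite mulnC divnK //; ring.
  rewrite sumrB -!mulr_suml sum_moebius // sum_moebius_ln // mulNr opprK; congr (_ + _).
  by case: eqP => [->|_]; rewrite ?mul0r // mul1r mulrC.
rewrite big_split /=; congr (_ + _).
rewrite big_nat_recl //= big1_seq ?addr0 // => i /andP[_].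
by rewrite mem_index_iota; case: i.
Qed.

End Arithmetic.

(** * Chebyshev and Mertens estimates *)

Section Summation.
Context {R : realType}.
Implicit Types (n m x k d : nat).

Lemma sum_hyperbola_sym (h : nat -> nat -> R) x :
  \sum_(1 <= d < x.+1) \sum_(1 <= m < (x %/ d).+1) h d m =
  \sum_(1 <= m < x.+1) \sum_(1 <= d < (x %/ m).+1) h d m.
Proof.
have E (g : nat -> nat -> R) : \sum_(1 <= d < x.+1) \sum_(1 <= m < (x %/ d).+1) g d m =
    \sum_(1 <= d < x.+1) \sum_(1 <= m < x.+1) if (d * m <= x)%N then g d m else 0.
  apply: eq_big_nat => d /andP[d0 _].
  rewrite (big_nat_widen _ _ x.+1) ?ltnS ?leq_div // [RHS]big_mkcond [LHS]big_mkcond /=.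
  by apply: eq_bigr => m _; rewrite ltnS leq_divRL // mulnC.
rewrite E (E (fun m d => h d m)) exchange_big /=.
by apply: eq_bigr => m _; apply: eq_bigr => d _; rewrite mulnC.
Qed.

Lemma sum_by_parts (a u : nat -> R) N :
  \sum_(1 <= k < N.+1) a k * u k =
  \sum_(1 <= k < N.+1) (\sum_(1 <= j < k.+1) a j) * (u k - u k.+1) +
  (\sum_(1 <= j < N.+1) a j) * u N.+1.
Proof.
elim: N => [|N IH]; first by rewrite !big_geq // mul0r addr0.
rewrite big_nat_recr //= IH [in RHS]big_nat_recr //=.
by rewrite ![\sum_(1 <= j < N.+2) a j]big_nat_recr //=; ring.
Qed.

Lemma sum_nat_weighted_diff (v : nat -> R) N :
  \sum_(1 <= k < N.+1) k%:R * (v k - v k.+1) =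
  \sum_(1 <= k < N.+1) v k - N%:R * v N.+1.
Proof.
elim: N => [|N IH]; first by rewrite !big_geq // mul0r subr0.
by rewrite big_nat_recr //= IH [in RHS]big_nat_recr //= -natr1; ring.
Qed.

Lemma natr_mul_invr_diff k : (0 < k)%N ->
  k%:R * (k%:R^-1 - k.+1%:R^-1) = k.+1%:R^-1 :> R.
Proof.
move=> k0; rewrite mulrBr mulfV ?pnatr_eq0 -?lt0n //.
rewrite -[X in X - _](@mulfV _ (k.+1%:R : R)) ?pnatr_eq0 //.
by rewrite -mulrBl -natr1 addrAC subrr add0r mul1r.
Qed.

Lemma natr_divn_le x n : (x %/ n)%:R <= x%:R / n%:R :> R.
Proof.
case: n => [|n]; first by rewrite divn0 mulr_ge0 ?invr_ge0.
by rewrite ler_pdivlMr ?ltr0n // -natrM ler_nat leq_divM.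
Qed.

Lemma natr_divn_gt x n : (0 < n)%N -> x%:R / n%:R < (x %/ n)%:R + 1 :> R.
Proof.
by move=> n0; rewrite ltr_pdivrMr ?ltr0n // natr1 -natrM ltr_nat ltn_ceil.
Qed.

End Summation.

Section Chebyshev.
Context {R : realType}.
Implicit Types (n m x k d : nat).
Local Notation mangoldt := (@mangoldt R).

Definition psi x : R := \sum_(1 <= n < x.+1) mangoldt n.

Definition lnfact x : R := \sum_(1 <= n < x.+1) ln n%:R.

Lemma psiS x : psi x.+1 = psi x + mangoldt x.+1.
Proof. by rewrite /psi big_nat_recr. Qed.

Lemma psi0 : psi 0 = 0.
Proof. by rewrite /psi big_geq. Qed.

Lemma ler_psi m n : (m <= n)%N -> psi m <= psi n.
Proof.
elim: n => [|n IH]; first by rewrite leqn0 => /eqP ->.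
rewrite leq_eqVlt => /orP[/eqP -> //|]; rewrite ltnS => /IH h.
by rewrite psiS (le_trans h) // lerDl mangoldt_ge0.
Qed.

Lemma psi_ge0 x : 0 <= psi x.
Proof. by rewrite -psi0 ler_psi. Qed.

Lemma lnfact_le x : lnfact x <= x%:R * ln x%:R.
Proof.
rewrite /lnfact mulr_natl -[X in _ *+ X]subn0 -[X in (X - _)%N]/(x.+1.-1) -subn1.
rewrite subn0 -sumr_const_nat; apply: ler_sum_nat => n /andP[n0 nx].
exact: ler_ln_nat.
Qed.

Lemma ln_nat_le x : ln (x%:R : R) <= x%:R.
Proof.
case: x => [|x]; first by rewrite ln0.
by apply/ltW/ln_sublinear; rewrite ltr0n.
Qed.

Lemma sum_mangoldt_divn x : \sum_(1 <= n < x.+1) mangoldt n * (x %/ n)%:R = lnfact x.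
Proof.
transitivity (\sum_(1 <= n < x.+1) \sum_(1 <= m < (x %/ n).+1) mangoldt n).
  by apply: eq_bigr => n _; rewrite sumr_const_nat subn1 /= mulr_natr.
rewrite -(sum_divisors_swap (fun d _ => mangoldt d)) /lnfact.
by apply: eq_big_nat => n /andP[n0 _]; exact: sum_mangoldt.
Qed.

Lemma sum_psi_divn x : \sum_(1 <= n < x.+1) psi (x %/ n) = lnfact x.
Proof.
rewrite /psi (sum_hyperbola_sym (fun _ m => mangoldt m)) -sum_mangoldt_divn.
by apply: eq_bigr => n _; rewrite sumr_const_nat subn1 /= mulr_natr.
Qed.

(* The classical comparison of x! with (x/2)!^2: the weights
   [x / n] - 2 [x / 2n] are nonnegative, and equal to 1 for x/2 < n <= x. *)
Lemma psi_half x : psi x - psi (x %/ 2) <= lnfact x - 2 * lnfact (x %/ 2).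
Proof.
have half_le : (x %/ 2 <= x)%N by rewrite leq_div.
have -> : lnfact (x %/ 2) = \sum_(1 <= n < x.+1) mangoldt n * (x %/ n %/ 2)%:R.
  rewrite -sum_mangoldt_divn [RHS](big_cat_nat (n := (x %/ 2).+1)) //=.
  rewrite [X in _ + X]big1_seq ?addr0; last first.
    move=> n /andP[_]; rewrite mem_index_iota => /andP[xn _].
    by rewrite divnAC divn_small // mulr0.
  by apply: eq_bigr => n _; rewrite divnAC.
rewrite -sum_mangoldt_divn mulr_sumr -sumrB /psi.
rewrite (big_cat_nat (n := (x %/ 2).+1)) //= addrAC subrr add0r.
rewrite [leRHS](big_cat_nat (n := (x %/ 2).+1)) //= -[leLHS]add0r.
have E n : mangoldt n * (x %/ n)%:R - 2 * (mangoldt n * (x %/ n %/ 2)%:R) =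
   mangoldt n * (x %/ n %% 2)%:R.
  by rewrite {1}(divn_eq (x %/ n) 2) natrD natrM; ring.
apply: lerD.
  by apply: sumr_ge0 => n _; rewrite E mulr_ge0 ?mangoldt_ge0.
apply: ler_sum_nat => n /andP[n1 n2]; rewrite E.
have -> : (x %/ n = 1)%N.
  apply/eqP; rewrite eqn_leq leq_divRL ?mul1n -1?ltnS; last by lia.
  by rewrite ltn_divLR; lia.
by rewrite modn_small // mulr1.
Qed.

(** By [psi_half] and Stirling's bounds, the increment from [h = x %/ 2] to [x] is at most
    [6 h + 4], and the induction leaves room for [10 h]. *)
Lemma psi_le x : psi x <= 10 * x%:R.
Proof.
elim/ltn_ind: x => x IH.
case: x IH => [|[|x]] IH; first by rewrite psi0 mulr0.
  by rewrite psiS psi0 mangoldt1; lra.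
set y := x.+2 in IH *; set h := (y %/ 2)%N.
have h0 : (0 < h)%N by rewrite divn_gt0.
have hy : (h < y)%N by rewrite ltn_Pdiv.
have := IH _ hy; have := psi_half y; rewrite -/h.
have yE : y%:R = h%:R * 2 + (y %% 2)%:R :> R.
  by rewrite {1}(divn_eq y 2) natrD natrM.
have b0 : (0 : R) <= (y %% 2)%:R by [].
have b1 : (y %% 2)%:R <= (1 : R) by rewrite lern1 -ltnS ltn_mod.
have H1 : (1 : R) <= h%:R by rewrite ler1n.
have := @sum_ln_le R y isT; have := @sum_ln_ge R h; rewrite -/(lnfact h) -/(lnfact y).
have lnh : 0 <= ln (h%:R : R) by exact: ln_nat_ge0.
have lnhh : ln (h%:R : R) <= h%:R by exact: ln_nat_le.
have lny : ln (y%:R : R) <= ln h%:R + 2.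
  have : ln (y%:R : R) <= ln (3 * h)%:R by apply: ler_ln_nat => //; rewrite {1}/h; lia.
  rewrite ln_natM // => h3; have := @le_ln1Dx R 2 ltac:(lra).
  have -> : 1 + 2 = 3 :> R by lra.
  lra.
have : y%:R * ln y%:R <= y%:R * (ln h%:R + 2) :> R by rewrite ler_wpM2l.
have : (y %% 2)%:R * ln h%:R <= ln h%:R :> R by rewrite ler_piMl.
move: lny lnhh; rewrite yE; set b : R := (y %% 2)%:R in b0 b1 *.
set H : R := h%:R in H1 *; set L := ln H in lnh *.
move: (ln (H * 2 + b)) (lnfact y) (lnfact h) (psi y) (psi h).
move=> *; lra.
Qed.

(** Removing the truncation in [sum_mangoldt_divn] costs between 0 and [psi x <= 10 x]; then divide
    by [x]. *)
Lemma mertens x : (0 < x)%N ->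
  -1 <= \sum_(1 <= n < x.+1) mangoldt n / n%:R - ln x%:R <= 10.
Proof.
move=> x0; have X0 : (0 : R) < x%:R by rewrite ltr0n.
set M := \sum_(_ <= _ < _) _.
have E : x%:R * M = lnfact x + \sum_(1 <= n < x.+1) mangoldt n * (x%:R / n%:R - (x %/ n)%:R).
  rewrite -sum_mangoldt_divn -big_split mulr_sumr /=; apply: eq_bigr => n _; ring.
have l1 : 0 <= \sum_(1 <= n < x.+1) mangoldt n * (x%:R / n%:R - (x %/ n)%:R).
  by apply: sumr_ge0 => n _; rewrite mulr_ge0 ?mangoldt_ge0 // subr_ge0 natr_divn_le.
have l2 : \sum_(1 <= n < x.+1) mangoldt n * (x%:R / n%:R - (x %/ n)%:R) <= psi x.
  apply: ler_sum_nat => n /andP[n0 _]; rewrite ler_piMr ?mangoldt_ge0 //.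
  by have := @natr_divn_gt R x n n0; lra.
have := psi_le x; have := @sum_ln_ge R x; have := lnfact_le x.
rewrite -/(lnfact x) => h1 h2 h3.
rewrite -(ler_pM2l X0) -[X in _ && X](ler_pM2l X0) mulrBr E.
by apply/andP; split; lra.
Qed.

End Chebyshev.

(** * Selberg's formula *)

Section Selberg.
Context {R : realType}.
Implicit Types (n m x k d : nat).
Local Notation mangoldt := (@mangoldt R).
Local Notation psi := (@psi R).
Local Notation lnfact := (@lnfact R).

Definition psi_err x : R := psi x - x%:R.

(** This 9 is the initial coefficient of the descent in [prime_number_theorem_psi]. *)
Lemma normr_rem_le x : `|psi_err x| <= 9 * x%:R.
Proof.
have := @psi_le R x; have := @psi_ge0 R x; have : (0 : R) <= x%:R by [].
by rewrite ler_norml /psi_err => h1 h2 h3; apply/andP; split; lra.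
Qed.

Lemma sum_ln_ratio_le x :
  \sum_(1 <= n < x.+1) (ln x%:R - ln n%:R) <= x%:R :> R.
Proof.
rewrite sumrB sumr_const_nat subn1 /= -[ln _ *+ _]mulr_natl.
by have := @sum_ln_ge R x; lra.
Qed.

Lemma ln_divn_le x d : (0 < d <= x)%N -> ln (x %/ d)%:R <= ln x%:R - ln d%:R :> R.
Proof.
move=> /andP[d0 dx]; rewrite -ln_div ?posrE ?ltr0n //; last exact: leq_trans dx.
rewrite ler_ln ?natr_divn_le // ?posrE ?divr_gt0 ?ltr0n ?divn_gt0 //.
exact: leq_trans dx.
Qed.

Lemma ln_divn_ge x d : (0 < d <= x)%N ->
  ln x%:R - ln d%:R <= ln (x %/ d)%:R + 1 :> R.
Proof.
move=> /andP[d0 dx]; have x0 : (0 < x)%N by exact: leq_trans dx.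
have q0 : (0 < x %/ d)%N by rewrite divn_gt0.
have q1 : (1 : R) <= (x %/ d)%:R by rewrite ler1n.
rewrite -ln_div ?posrE ?ltr0n //.
have h : ln (x%:R / d%:R) - ln (x %/ d)%:R <= (x%:R / d%:R - (x %/ d)%:R) / (x %/ d)%:R :> R.
  by apply: ln_subl_le; rewrite ?divr_gt0 ?ltr0n.
have : (x%:R / d%:R - (x %/ d)%:R) / (x %/ d)%:R <= 1 :> R.
  rewrite ler_pdivrMr ?ltr0n // mul1r.
  by have := @natr_divn_gt R x d d0; lra.
lra.
Qed.

(* The constant [1 + (harm x - ln x)], close to 1 + gamma, makes the divisor sums
   of this function logarithmically small. *)
Let F x k : R := psi (x %/ k) - x%:R / k%:R + (1 + (harm x - ln x%:R)).

(** With [m = x %/ d], the main terms [m ln m], [m] and [g m] cancel. There remain the Stirling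
    error, the truncation error [(y - m) (ln m + g + e2)] with [y - m < 1], and [m e2 <= 1]. *)
Let sum_F_multiples x d : (0 < d <= x)%N ->
  `|\sum_(1 <= n < (x %/ d).+1) F x (d * n)| <= (ln x%:R - ln d%:R) + 3.
Proof.
move=> dx; have /andP[d0 dx'] := dx.
have x0 : (0 < x)%N by exact: leq_trans dx'.
set m := (x %/ d)%N; have m0 : (0 < m)%N by rewrite divn_gt0.
have -> : \sum_(1 <= n < m.+1) F x (d * n) =
    lnfact m - x%:R / d%:R * harm m + (1 + (harm x - ln x%:R)) * m%:R.
  rewrite /F big_split sumrB sumr_const_nat subn1 /= mulr_natr; congr (_ - _ + _).
    by rewrite -sum_psi_divn; apply: eq_bigr => n _; rewrite divnMA.
  rewrite /harm mulr_sumr; apply: eq_bigr => n _.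
  by rewrite natrM invfM mulrA.
have := @ln_divn_le x d dx; rewrite -/m => lm.
have mx : (0 < m <= x)%N by rewrite m0 leq_div.
have := @harm_sub_ln R m x mx.
have := @harm_le R x x0; have := @harm_ge R x x0.
have := @sum_ln_le R m m0; have := @sum_ln_ge R m; rewrite -/(lnfact m).
have y1 : m%:R <= x%:R / d%:R :> R by apply: natr_divn_le.
have y2 : x%:R / d%:R < m%:R + 1 :> R by apply: natr_divn_gt.
set y : R := x%:R / d%:R in y1 y2 *.
set g := harm x - ln x%:R => T1 T2 G1 G2 /andP[H1 H2].
have g0 : 0 <= g by rewrite /g; lra.
have g1 : g <= 1 by rewrite /g; lra.
have m1 : (1 : R) <= m%:R by rewrite ler1n.
have lm0 : 0 <= ln (m%:R : R) by exact: ln_nat_ge0.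
(* [e2] is the decrease of [harm - ln] from [m] to [x], at most [1 / m] by [harm_sub_ln]. *)
set e2 := harm m - ln m%:R - g.
have e2m : m%:R * e2 <= 1.
  have : m%:R * e2 <= m%:R * m%:R^-1 by rewrite ler_wpM2l // /e2; lra.
  by rewrite mulfV // gt_eqF // ltr0n.
have e20 : 0 <= e2 by rewrite /e2; lra.
have -> : lnfact m - y * harm m + (1 + g) * m%:R =
   (lnfact m - (m%:R * ln m%:R - m%:R)) - (y - m%:R) * (ln m%:R + g + e2) - m%:R * e2.
  by rewrite /e2; ring.
have p1 : 0 <= (y - m%:R) * (ln m%:R + g + e2).
  by rewrite mulr_ge0 //; lra.
have e21 : e2 <= 1.
  by apply: le_trans e2m; rewrite ler_peMl.
have p3 : 0 <= m%:R * e2 by rewrite mulr_ge0.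
have p2 : (y - m%:R) * (ln m%:R + g + e2) <= ln m%:R + g + e2.
  by rewrite ler_piMl //; lra.
clearbody g e2; rewrite ler_norml; apply/andP; split; lra.
Qed.

Lemma normr_sum_le (I : eqType) (r : seq I) (f g : I -> R) :
  (forall i, i \in r -> `|f i| <= g i) -> `|\sum_(i <- r) f i| <= \sum_(i <- r) g i.
Proof.
move=> h; apply: le_trans (ler_norm_sum _ _ _) _.
by rewrite big_seq [leRHS]big_seq; apply: ler_sum.
Qed.

(** In [tatuzawa_iseki] the term [d] is at most [L ^ 2 + 3 L] with [L = ln x - ln d]; both sums over
    [d] are [O(x)]. *)
Let selberg_raw x : (0 < x)%N ->
  `|F x 1 * ln x%:R + \sum_(1 <= k < x.+1) mangoldt k * F x k| <= 6 * x%:R.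
Proof.
move=> x0; rewrite -tatuzawa_iseki //.
apply: (@le_trans _ _ (\sum_(1 <= d < x.+1)
   ((ln x%:R - ln d%:R) ^+ 2 + 3 * (ln x%:R - ln d%:R)))); last first.
  rewrite big_split /= -mulr_sumr.
  by have := @sum_sqr_ln_ratio R x; have := sum_ln_ratio_le x; lra.
apply: normr_sum_le => d; rewrite mem_index_iota ltnS => dx.
have /andP[d0 dx'] := dx.
have L0 : 0 <= ln x%:R - ln d%:R :> R by rewrite subr_ge0 ler_ln_nat.
rewrite !normrM (ger0_norm L0).
set L := ln x%:R - ln d%:R in L0 *.
have -> : L ^+ 2 + 3 * L = 1 * L * (L + 3) by ring.
apply: ler_pM; rewrite ?mulr_ge0 // ?sum_F_multiples //.
by rewrite ler_wpM2r // normr_moebius_le1.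
Qed.

(** Passing from [F] to [psi_err] costs [(1 + g) (ln x + psi x)] for the constant and at most
    [psi x] for the truncated quotients. *)
Lemma selberg_rem x :
  `|psi_err x * ln x%:R + \sum_(1 <= k < x.+1) mangoldt k * psi_err (x %/ k)| <= 40 * x%:R.
Proof.
have [->|x0] := posnP x.
  by rewrite big_geq // addr0 /psi_err psi0 subrr mul0r mulr0 normr0.
set g := harm x - ln (x%:R : R).
have g0 : 0 <= g by have := @harm_ge R x x0; rewrite /g; lra.
have g1 : g <= 1 by have := @harm_le R x x0; rewrite /g; lra.
have E : psi_err x * ln x%:R + \sum_(1 <= k < x.+1) mangoldt k * psi_err (x %/ k) =
  (F x 1 * ln x%:R + \sum_(1 <= k < x.+1) mangoldt k * F x k)
  - (1 + g) * ln x%:R - (1 + g) * psi x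
  + \sum_(1 <= k < x.+1) mangoldt k * (x%:R / k%:R - (x %/ k)%:R).
  have -> : F x 1 = psi_err x + (1 + g) by rewrite /F /psi_err divn1 invr1 mulr1.
  rewrite [(1 + g) * psi x]mulrC mulr_suml.
  have -> : \sum_(1 <= k < x.+1) mangoldt k * psi_err (x %/ k) =
    \sum_(1 <= k < x.+1) mangoldt k * F x k -
    \sum_(1 <= i < x.+1) mangoldt i * (1 + g) +
    \sum_(1 <= k < x.+1) mangoldt k * (x%:R / k%:R - (x %/ k)%:R).
    rewrite -sumrB -big_split /=; apply: eq_bigr => k _.
    by rewrite /F /psi_err -/g; ring.
  by ring.
have l1 : 0 <= \sum_(1 <= n < x.+1) mangoldt n * (x%:R / n%:R - (x %/ n)%:R).
  by apply: sumr_ge0 => n _; rewrite mulr_ge0 ?mangoldt_ge0 // subr_ge0 natr_divn_le.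
have l2 : \sum_(1 <= n < x.+1) mangoldt n * (x%:R / n%:R - (x %/ n)%:R) <= psi x.
  apply: ler_sum_nat => n /andP[n0 _]; rewrite ler_piMr ?mangoldt_ge0 //.
  by have := @natr_divn_gt R x n n0; lra.
have a1 : 0 <= (1 + g) * ln x%:R by rewrite mulr_ge0 ?ln_nat_ge0 //; lra.
have a2 : (1 + g) * ln x%:R <= 2 * x%:R.
  by apply: ler_pM; rewrite ?ln_nat_ge0 ?ln_nat_le //; lra.
have a3 : 0 <= (1 + g) * psi x by rewrite mulr_ge0 ?psi_ge0 //; lra.
have a4 : (1 + g) * psi x <= 2 * (10 * x%:R).
  by apply: ler_pM; rewrite ?psi_ge0 ?psi_le //; lra.
have := selberg_raw x x0; rewrite !ler_norml E => /andP[b1 b2].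
have := @psi_le R x.
move: b1 b2 l1 l2; set S1 := _ + \sum_(_ <= _ < _) _; set S2 := \sum_(_ <= _ < _) _.
by move=> *; apply/andP; split; lra.
Qed.

(** By partial summation, since [psi n * (ln (n + 1) - ln n) <= 10]. It exchanges the weights [ln x]
    and [ln n] in [selberg_sum]. *)
Lemma sum_mangoldt_ln_ratio x :
  0 <= \sum_(1 <= n < x.+1) mangoldt n * (ln x%:R - ln n%:R) <= 10 * x%:R.
Proof.
apply/andP; split.
  rewrite big_nat; apply: sumr_ge0 => n /andP[n0 nx].
  by rewrite mulr_ge0 ?mangoldt_ge0 // subr_ge0 ler_ln_nat.
rewrite (sum_by_parts _ (fun n => ln x%:R - ln n%:R)) -/(psi x).
have [->|x0] := posnP x; first by rewrite big_geq // psi0 mul0r mulr0 addr0.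
have -> : 10 * x%:R = \sum_(1 <= n < x.+1) 10 + 0 :> R.
  by rewrite sumr_const_nat subn1 addr0 mulr_natr.
apply: lerD; last first.
  by rewrite mulr_ge0_le0 ?psi_ge0 // subr_le0 ler_ln_nat.
apply: ler_sum_nat => n /andP[n0 _]; rewrite -/(psi n).
have -> : ln x%:R - ln n%:R - (ln x%:R - ln n.+1%:R) = ln n.+1%:R - ln n%:R :> R by ring.
apply: (@le_trans _ _ (10 * n%:R * n%:R^-1)); last first.
  by rewrite -mulrA mulfV ?mulr1 // pnatr_eq0 -lt0n.
apply: ler_pM; rewrite ?psi_ge0 ?psi_le ?ln_succ_le //.
by rewrite subr_ge0 ler_ln_nat.
Qed.

(** Selberg's function, [mangoldt * ln] plus the Dirichlet square of [mangoldt]. *)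
Definition mangoldt2 k : R :=
  mangoldt k * ln k%:R + \sum_(1 <= d < k.+1 | (d %| k)%N) mangoldt d * mangoldt (k %/ d).

Lemma sum_mangoldt2 x : \sum_(1 <= k < x.+1) mangoldt2 k =
  \sum_(1 <= k < x.+1) mangoldt k * ln k%:R + \sum_(1 <= k < x.+1) mangoldt k * psi (x %/ k).
Proof.
rewrite big_split /=; congr (_ + _).
rewrite (sum_divisors_swap (fun d m => mangoldt d * mangoldt m)).
by apply: eq_bigr => d _; rewrite mulr_sumr.
Qed.

(** The errors are [40 x] from [selberg_rem], [x] from Stirling and [10 x] from
    [sum_mangoldt_ln_ratio]. *)
Lemma selberg_sum x :
  `|\sum_(1 <= k < x.+1) mangoldt2 k - 2 * x%:R * ln x%:R| <= 51 * x%:R.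
Proof.
rewrite sum_mangoldt2.
set A := \sum_(_ <= _ < _) _; set B := \sum_(_ <= _ < _) _.
have := sum_mangoldt_ln_ratio x.
under eq_bigr do rewrite mulrBr.
rewrite sumrB -mulr_suml -/A -/(psi x) => /andP[D0 D1].
have := selberg_rem x.
have -> : \sum_(1 <= k < x.+1) mangoldt k * psi_err (x %/ k) = B - lnfact x.
  by rewrite -sum_mangoldt_divn -sumrB; apply: eq_bigr => k _; rewrite /psi_err mulrBr.
rewrite !ler_norml /psi_err mulrBl => /andP[S0 S1].
have := @lnfact_le R x; have := @sum_ln_ge R x; rewrite -/(lnfact x) => T0 T1.
by apply/andP; split; lra.
Qed.

End Selberg.

(** * Iterated Selberg inequality and variation of the remainder *)

Section Remainder.
Context {R : realType}.
Implicit Types (n m x k d : nat).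
Local Notation mangoldt := (@mangoldt R).
Local Notation mangoldt2 := (@mangoldt2 R).
Local Notation psi := (@psi R).
Local Notation lnfact := (@lnfact R).
Local Notation psi_err := (@psi_err R).

Lemma rem0 : psi_err 0 = 0.
Proof. by rewrite /psi_err psi0 subrr. Qed.

(* Selberg's formula, applied at [x] and at every [x / n]. *)
Lemma selberg_iterated x :
  `|psi_err x| * ln x%:R ^+ 2 <=
  \sum_(1 <= k < x.+1) mangoldt2 k * `|psi_err (x %/ k)| + 89 * (x%:R * ln x%:R).
Proof.
pose E m := psi_err m * ln m%:R + \sum_(1 <= k < m.+1) mangoldt k * psi_err (m %/ k).
have EC m : `|E m| <= 40 * m%:R by exact: selberg_rem.
(* The defect [dl n], in [[0, 1]], comes from truncating [x / n]. *)
pose dl n : R := ln x%:R - ln n%:R - ln (x %/ n)%:R.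
have dlC n : (0 < n <= x)%N -> 0 <= dl n <= 1.
  move=> nx; have := @ln_divn_le R x n nx; have := @ln_divn_ge R x n nx.
  by rewrite /dl => *; apply/andP; split; lra.
have lnx := @ln_nat_ge0 R x.
have -> : `|psi_err x| * ln x%:R ^+ 2 = `|psi_err x * ln x%:R ^+ 2|.
  by rewrite normrM (ger0_norm (sqr_ge0 _)).
(* In [E x * ln x], write [ln x = ln n + ln (x %/ n) + dl n] and use the definition of [E (x %/ n)].
   The coefficient of [psi_err (x %/ n)] becomes the Dirichlet square minus [mangoldt n * ln n]. *)
have -> : psi_err x * ln x%:R ^+ 2 = E x * ln x%:R +
   (\sum_(1 <= n < x.+1) ((mangoldt2 n - 2 * (mangoldt n * ln n%:R)) * psi_err (x %/ n)) +
   \sum_(1 <= n < x.+1) mangoldt n * (- E (x %/ n)%N - psi_err (x %/ n) * dl n)).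
  have H : \sum_(1 <= n < x.+1) (mangoldt2 n - mangoldt n * ln n%:R) * psi_err (x %/ n) =
      \sum_(1 <= n < x.+1) mangoldt n *
        \sum_(1 <= m < (x %/ n).+1) mangoldt m * psi_err (x %/ n %/ m).
    under [RHS]eq_bigr do rewrite mulr_sumr.
    rewrite -(sum_divisors_swap
      (fun d m => mangoldt d * (mangoldt m * psi_err (x %/ d %/ m)))).
    apply: eq_bigr => n _; rewrite /mangoldt2 addrAC subrr add0r mulr_suml.
    by apply: eq_bigr => d dn; rewrite -divnMA mulnC divnK // mulrA.
  have -> : \sum_(1 <= n < x.+1) (mangoldt2 n - 2 * (mangoldt n * ln n%:R)) *
      psi_err (x %/ n) =
    \sum_(1 <= n < x.+1) (mangoldt2 n - mangoldt n * ln n%:R) * psi_err (x %/ n) -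
    \sum_(1 <= n < x.+1) mangoldt n * ln n%:R * psi_err (x %/ n).
    by rewrite -sumrB; apply: eq_bigr => n _; ring.
  have -> : E x * ln x%:R = psi_err x * ln x%:R ^+ 2 +
      \sum_(1 <= n < x.+1) mangoldt n * (ln x%:R * psi_err (x %/ n)).
    rewrite /E; move: (psi_err x) => r; rewrite mulrDl mulr_suml expr2 mulrA; congr (_ + _).
    by apply: eq_bigr => n _; rewrite mulrAC mulrA.
  rewrite H -sumrB -!big_split /= -[LHS]addr0 -addrA; congr (_ + _).
  by rewrite -big_split big1 //= => n _; rewrite /E /dl; ring.
apply: le_trans (ler_normD _ _) _.
have -> : 89 * (x%:R * ln x%:R) = 40 * x%:R * ln x%:R + 49 * (x%:R * ln x%:R) :> R.
  by ring.
rewrite addrCA; apply: lerD; first by rewrite normrM (ger0_norm lnx) ler_wpM2r.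
apply: le_trans (ler_normD _ _) _; apply: lerD.
  apply: normr_sum_le => n _; rewrite normrM ler_wpM2r //.
  (* The coefficient is a difference of two nonnegative terms whose sum is [mangoldt2 n]. *)
  have h1 : 0 <= mangoldt n * ln n%:R by rewrite mulr_ge0 ?mangoldt_ge0 ?ln_nat_ge0.
  have h2 : mangoldt n * ln n%:R <= mangoldt2 n.
    by rewrite lerDl; apply: sumr_ge0 => d _; rewrite mulr_ge0 ?mangoldt_ge0.
  by rewrite ler_norml; apply/andP; split; lra.
(* Here 49 is 40 for [E], by [selberg_rem], plus 9 for [psi_err], by [normr_rem_le]. *)
apply: (@le_trans _ _ (\sum_(1 <= n < x.+1) mangoldt n * (49 * (x %/ n)%:R))); last first.
  under eq_bigr do rewrite mulrCA.
  by rewrite -mulr_sumr sum_mangoldt_divn ler_wpM2l // lnfact_le.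
apply: normr_sum_le => n; rewrite mem_index_iota ltnS => nx.
rewrite normrM (ger0_norm (mangoldt_ge0 _)) ler_wpM2l ?mangoldt_ge0 //.
apply: le_trans (ler_normB _ _) _.
rewrite normrN normrM; have /andP[dl0 dl1] := dlC n nx.
have := EC (x %/ n)%N; have := @normr_rem_le R (x %/ n).
have : `|psi_err (x %/ n)| * `|dl n| <= `|psi_err (x %/ n)| by rewrite ler_piMr // ger0_norm.
by move=> *; lra.
Qed.

(** The majorant is the variation of a monotone function, to which partial summation can be applied
    in reverse. *)
Lemma normr_rem_diff_le m n : (m <= n)%N ->
  `| `|psi_err n| - `|psi_err m| | <= (psi n + n%:R) - (psi m + m%:R).
Proof.
move=> mn; apply: le_trans (ler_dist_dist _ _) _.
have h1 := @ler_psi R _ _ mn; have h2 : m%:R <= n%:R :> R by rewrite ler_nat.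
by rewrite /psi_err ler_norml; apply/andP; split; lra.
Qed.

(** In [selberg_iterated], replace [mangoldt2] by its mean [2 ln] by partial summation: the partial
    sums of the difference are at most [53 k], and the variation of the remainder is that of the
    monotone [v] at most, with the sum of [v] being [O(x ln x + x)]. *)
Lemma selberg_bound x :
  `|psi_err x| * ln x%:R ^+ 2 <=
  2 * (\sum_(1 <= k < x.+1) ln k%:R * `|psi_err (x %/ k)|) + 200 * (x%:R * (ln x%:R + 1)).
Proof.
have [->|x0] := posnP x; first by rewrite rem0 normr0 mul0r big_geq // !(mul0r, mulr0) addr0.
have X0 : (0 : R) <= x%:R by [].
have lnx := @ln_nat_ge0 R x.
have XL : 0 <= x%:R * ln (x%:R : R) by rewrite mulr_ge0.
suff : \sum_(1 <= k < x.+1) (mangoldt2 k - 2 * ln k%:R) * `|psi_err (x %/ k)| <=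
    53 * (2 * x%:R * ln x%:R + x%:R).
  under eq_bigr do rewrite mulrBl -mulrA.
  rewrite sumrB -mulr_sumr => h; have := selberg_iterated x; lra.
rewrite sum_by_parts (divn_small (ltnSn x)) rem0 normr0 mulr0 addr0.
pose v k : R := psi (x %/ k) + (x %/ k)%:R.
apply: (@le_trans _ _ (\sum_(1 <= k < x.+1) 53 * (k%:R * (v k - v k.+1)))); last first.
  rewrite -mulr_sumr ler_wpM2l // sum_nat_weighted_diff.
  rewrite {2}/v (divn_small (ltnSn x)) psi0 addr0 mulr0 subr0 /v big_split /=.
  rewrite sum_psi_divn; have := @lnfact_le R x.
  have : \sum_(1 <= k < x.+1) (x %/ k)%:R <= x%:R * harm x :> R.
    by rewrite /harm mulr_sumr; apply: ler_sum => k _; exact: natr_divn_le.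
  have : x%:R * harm x <= x%:R * (ln x%:R + 1) :> R by rewrite ler_wpM2l // harm_le.
  by move=> *; lra.
apply: ler_sum_nat => k /andP[k0 _].
apply: le_trans (ler_norm _) _; rewrite normrM mulrA.
apply: ler_pM => //; last first.
  by apply: normr_rem_diff_le; rewrite leq_div2l.
rewrite sumrB -mulr_sumr -/(lnfact k).
have := @selberg_sum R k; rewrite !ler_norml => /andP[S0 S1].
have := @lnfact_le R k; have := @sum_ln_ge R k; rewrite -/(lnfact k) => T0 T1.
by apply/andP; split; lra.
Qed.

(** A discrete form of the boundedness of the integral of [r(t) / t^2]: partial summation in
    [mertens], with the harmonic sum cancelling [ln x]. *)
Lemma sum_rem_weighted x :
  `|\sum_(1 <= k < x.+1) psi_err k * (k%:R^-1 - k.+1%:R^-1)| <= 12.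
Proof.
have [->|x0] := posnP x; first by rewrite big_geq // normr0.
have := @mertens R x x0; rewrite (sum_by_parts mangoldt (fun n => n%:R^-1)) -/(psi x).
have -> : \sum_(1 <= k < x.+1) psi_err k * (k%:R^-1 - k.+1%:R^-1) =
  \sum_(1 <= k < x.+1) psi k * (k%:R^-1 - k.+1%:R^-1) - (harm x + x.+1%:R^-1 - 1).
  have -> : harm x + x.+1%:R^-1 - 1 = \sum_(1 <= k < x.+1) k.+1%:R^-1 :> R.
    by rewrite -harmS /harm big_nat_recl //= invr1 addrAC subrr add0r.
  rewrite -sumrB.
  apply: eq_big_nat => k /andP[k0 _]; rewrite /psi_err mulrBl; congr (_ - _).
  exact: natr_mul_invr_diff.
have i0 : 0 <= x.+1%:R^-1 :> R by rewrite invr_ge0.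
have i1 : x.+1%:R^-1 <= 1 :> R by rewrite invf_le1 ?ler1n ?ltr0n.
have p0 : 0 <= psi x * x.+1%:R^-1 by rewrite mulr_ge0 ?psi_ge0.
have p1 : psi x * x.+1%:R^-1 <= 10.
  rewrite ler_pdivrMr ?ltr0n // (le_trans (psi_le x)) // ler_wpM2l // ler_nat //.
rewrite -/(psi x).
have := @harm_ge R x x0; have := @harm_le R x x0.
set S := \sum_(_ <= _ < _) _; move: i0 i1 p0 p1.
set p := psi x * _; set q := x.+1%:R^-1 => i0 i1 p0 p1 h1 h2 /andP[M0 M1].
by rewrite ler_norml; apply/andP; split; lra.
Qed.

(** Subtract [selberg_sum] at [m] from that at [n] and drop the nonnegative Dirichlet square in
    [mangoldt2]. *)
Lemma psi_short_interval m n : (0 < m <= n)%N -> (n <= 2 * m)%N ->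
  (psi n - psi m) * ln m%:R <= 2 * (n%:R - m%:R) * ln m%:R + 106 * n%:R.
Proof.
move=> /andP[m0 mn] n2.
have M0 : (0 : R) < m%:R by rewrite ltr0n.
have N0 : (0 : R) < n%:R by rewrite ltr0n (leq_trans m0).
have MN : m%:R <= n%:R :> R by rewrite ler_nat.
have N2 : n%:R <= 2 * m%:R :> R by rewrite -natrM ler_nat.
have H : (psi n - psi m) * ln m%:R <=
    \sum_(1 <= k < n.+1) mangoldt2 k - \sum_(1 <= k < m.+1) mangoldt2 k.
  rewrite /psi ![\sum_(1 <= _ < n.+1) _](big_cat_nat (n := m.+1)) //=.
  have e1 (a b : R) : a + b - a = b by ring.
  rewrite !e1 mulr_suml.
  apply: ler_sum_nat => k /andP[mk _].
  apply: (@le_trans _ _ (mangoldt k * ln k%:R)).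
    by rewrite ler_wpM2l ?mangoldt_ge0 // ler_ln_nat // ltnW.
  by rewrite lerDl; apply: sumr_ge0 => d _; rewrite mulr_ge0 ?mangoldt_ge0.
have := @selberg_sum R n; have := @selberg_sum R m; rewrite !ler_norml.
move=> /andP[A0 A1] /andP[B0 B1].
have L : n%:R * (ln n%:R - ln m%:R) <= 2 * n%:R :> R.
  rewrite [leRHS]mulrC ler_pM2l //; apply: le_trans (ln_subl_le _ _ _ _) _ => //.
  by rewrite ler_pdivrMr //; lra.
lra.
Qed.

Lemma ln_unbounded (C : R) : exists2 Y, (0 < Y)%N & forall n, (Y <= n)%N -> C <= ln n%:R.
Proof.
exists (Num.truncn (expR C)).+1 => // n Yn.
rewrite -[C]expRK ler_ln ?posrE ?expR_gt0 // ?ltr0n ?(leq_trans _ Yn) //.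
by apply: le_trans (ltW (truncnS_gt _)) _; rewrite ler_nat.
Qed.

(** Dividing [psi_short_interval] by [ln m] puts the increment of [psi] between 0 and
    [2 (n - m) + e n]; subtracting [n - m] centers it. *)
Lemma rem_short_interval (e : R) : 0 < e -> exists2 Y, (0 < Y)%N &
  forall m n, (Y <= m <= n)%N -> (n <= 2 * m)%N ->
  `|psi_err n - psi_err m| <= (n%:R - m%:R) + e * n%:R.
Proof.
move=> e0; have [Y Y0 HY] := ln_unbounded (106 / e + 1).
exists Y => // m n /andP[Ym mn] n2; have m0 := leq_trans Y0 Ym.
have MN : m%:R <= n%:R :> R by rewrite ler_nat.
have N0 : 0 <= e * n%:R by rewrite mulr_ge0 // ltW.
have Lm := HY m Ym.
have L0 : 0 < ln (m%:R : R) by apply: lt_le_trans Lm; rewrite ltr_wpDl ?divr_ge0 // ltW.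
have := @psi_short_interval m n; rewrite m0 mn => /(_ isT n2) h.
have h2 : 106 * n%:R <= e * n%:R * ln m%:R.
  rewrite mulrAC ler_wpM2r //.
  apply: le_trans (_ : e * (106 / e) <= _); first by rewrite mulrCA mulfV ?mulr1 // gt_eqF.
  by rewrite ler_wpM2l ?(ltW e0) //; lra.
have : psi n - psi m <= 2 * (n%:R - m%:R) + e * n%:R.
  by rewrite -(ler_pM2r L0); lra.
have := @ler_psi R _ _ mn.
by rewrite /psi_err ler_norml => *; apply/andP; split; lra.
Qed.

End Remainder.

(** * Intervals where the remainder is small *)

Section GoodIntervals.
Context {R : realType}.
Implicit Types (n m x k d : nat).
Local Notation psi_err := (@psi_err R).

Lemma natr_unbounded (C : R) : exists2 Y, (0 < Y)%N & forall n, (Y <= n)%N -> C <= n%:R.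
Proof.
exists (Num.truncn C).+1 => // n Yn.
by apply: le_trans (ltW (truncnS_gt _)) _; rewrite ler_nat.
Qed.

(* The sign of [psi_err] cannot change without [psi_err] being small, and it cannot stay
   constant for long by [sum_rem_weighted]. *)
Lemma rem_small_somewhere (e : R) : 0 < e -> exists2 K, (0 < K)%N &
  exists2 Y, (0 < Y)%N & forall y, (Y <= y)%N ->
  exists n, (y <= n <= K * y)%N /\ `|psi_err n| <= e * n%:R.
Proof.
move=> e0; have [K K0 HK] := @ln_unbounded R (25 / e + 2).
have [Y1 Y10 HY1] := @rem_short_interval R (e / 4) ltac:(lra).
have [Y2 Y20 HY2] := natr_unbounded (4 / e).
exists K => //; exists (maxn Y1 Y2); first by rewrite leq_max Y10.
move=> y; rewrite geq_max => /andP[yY1 yY2].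
have y0 : (0 < y)%N by exact: leq_trans yY1.
apply: contrapT => H.
have {}H n : (y <= n <= K * y)%N -> e * n%:R < `|psi_err n|.
  by move=> h; rewrite ltNge; apply/negP => h'; apply: H; exists n.
pose s : R := if 0 <= psi_err y then 1 else -1.
have s1 : `|s| = 1 by rewrite /s; case: ifP => _; rewrite ?normrN normr1.
have sign n : (y <= n <= K * y)%N -> e * n%:R < s * psi_err n.
  elim: n => [|n IH]; first by rewrite leqn0 => /andP[/eqP y00]; rewrite y00 in y0.
  move=> h; have /andP[] := h; rewrite leq_eqVlt => /orP[/eqP yn _|].
    have := H _ h; rewrite /s yn; case: ifP => [h1|]; first by rewrite ger0_norm // mul1r.
    by move/negbT; rewrite -ltNge => h1; rewrite ltr0_norm // mulN1r.
  rewrite ltnS => yn nK; have h' : (y <= n <= K * y)%N by rewrite yn ltnW.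
  have {}IH := IH h'.
  have n0 : (0 < n)%N by exact: leq_trans yn.
  have d := HY1 n n.+1; rewrite (leq_trans yY1 yn) leqnSn in d.
  have {}d := d isT ltac:(lia).
  have en : 1 <= e / 4 * n%:R.
    have := HY2 n (leq_trans yY2 yn); rewrite ler_pdivrMr // => h2; lra.
  (* From [n] to [n + 1] the remainder moves against the sign [s] by at most [3 e n / 4], so it
     cannot cross zero. *)
  have pos : 0 < s * psi_err n.+1.
    have : s * psi_err n.+1 = s * psi_err n + s * (psi_err n.+1 - psi_err n) by ring.
    have : `|s * (psi_err n.+1 - psi_err n)| <= n.+1%:R - n%:R + e / 4 * n.+1%:R.
      by rewrite normrM s1 mul1r.
    rewrite ler_norml => /andP[l1 l2] ->.
    have e4 : e / 4 * 1 <= e / 4 * n%:R by rewrite ler_wpM2l ?ler1n //; lra.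
    by move: l1; rewrite -natr1 => l1; lra.
  by have := H _ h; rewrite -[`|psi_err _|]mul1r -s1 -normrM gtr0_norm.
pose N := (K * y)%N.
have yN : (y <= N)%N by rewrite leq_pmull.
pose S := \sum_(y <= k < N.+1) psi_err k * (k%:R^-1 - k.+1%:R^-1).
have S24 : `|S| <= 24.
  have := @sum_rem_weighted R N; rewrite (big_cat_nat (n := y)) //=; last exact: leqW.
  have := @sum_rem_weighted R y.-1; rewrite prednK // -/S.
  by rewrite !ler_norml => /andP[a1 a2] /andP[a3 a4]; apply/andP; split; lra.
have sS : e * (harm N.+1 - harm y) <= s * S.
  have -> : harm N.+1 - harm y = \sum_(y <= k < N.+1) k.+1%:R^-1 :> R.
    rewrite /harm (big_cat_nat (n := y.+1)) //= ?ltnS ?leqW // addrAC subrr add0r.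
    by rewrite big_add1.
  rewrite /S !mulr_sumr; apply: ler_sum_nat => k /andP[yk kN].
  have k0 : (0 < k)%N by exact: leq_trans yk.
  rewrite -{1}natr_mul_invr_diff // !mulrA ler_wpM2r //; last first.
    by apply: ltW; apply: sign; rewrite yk.
  by rewrite subr_ge0 lef_pV2 ?posrE ?ltr0n // ler_nat.
have : s * S <= 24 by apply: le_trans (ler_norm _) _; rewrite normrM s1 mul1r.
have := @harm_ge R N.+1 isT; have := @harm_le R y y0.
have : ln (N%:R : R) <= ln N.+1%:R by apply: ler_ln_nat => //; rewrite muln_gt0 K0.
rewrite {1}/N ln_natM // => a1 a2 a3 a4.
have := HK K (leqnn K) => a5.
have : e * (25 / e + 1) <= e * (harm N.+1 - harm y) by rewrite ler_wpM2l ?(ltW e0) //; lra.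
rewrite mulrDr mulr1 mulrCA mulfV ?gt_eqF // mulr1; lra.
Qed.

(** The three [e] stand for the value at [n], the length [m - n <= e n], and the error in
    [rem_short_interval]. *)
Lemma rem_small_interval (e : R) : 0 < e <= 1 / 2 -> exists2 K, (0 < K)%N &
  exists2 Y, (0 < Y)%N & forall y, (Y <= y)%N ->
  exists n, (y <= n <= K * y)%N /\
    forall m, (n <= m)%N -> m%:R <= (1 + e) * n%:R -> `|psi_err m| <= 3 * e * m%:R.
Proof.
move=> /andP[e0 e1]; have [K K0 [Y1 Y10 HY1]] := rem_small_somewhere e e0.
have [Y2 Y20 HY2] := @rem_short_interval R e e0.
exists K => //; exists (maxn Y1 Y2); first by rewrite leq_max Y10.
move=> y; rewrite geq_max => /andP[yY1 yY2].
have [n [yn rn]] := HY1 y yY1; exists n; split => // m nm mn.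
have /andP[yn' _] := yn.
have NM : n%:R <= m%:R :> R by rewrite ler_nat.
have N0 : (0 : R) <= n%:R by [].
have m2 : (m <= 2 * n)%N.
  rewrite -(ler_nat R) natrM; apply: le_trans mn _; rewrite ler_wpM2r //; lra.
have := HY2 n m; rewrite (leq_trans yY2 yn') nm => /(_ isT m2) h.
have -> : psi_err m = psi_err n + (psi_err m - psi_err n) by ring.
apply: le_trans (ler_normD _ _) _.
have : e * n%:R <= e * m%:R by rewrite ler_wpM2l // ltW.
lra.
Qed.

Lemma ler_sum_subrange (f : nat -> R) a b N : (forall k, 0 <= f k) -> (0 < a)%N -> (b <= N)%N ->
  \sum_(a <= k < b) f k <= \sum_(1 <= k < N) f k.
Proof.
move=> f0 a0 bN; have [ab|ba] := leqP a b; last first.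
  by rewrite big_geq ?(ltnW ba) //; apply: sumr_ge0.
rewrite [leRHS](big_cat_nat (n := a)) //=; last exact: leq_trans bN.
rewrite [X in _ <= _ + X](big_cat_nat (n := b)) //=.
have h1 : 0 <= \sum_(1 <= k < a) f k by apply: sumr_ge0.
have h2 : 0 <= \sum_(b <= k < N) f k by apply: sumr_ge0.
by lra.
Qed.

(** The [k] in []z, x / n]] qualify, and there are at least [e x / (2 n)] of them. Each satisfies
    [k ^ 2 >= x], because [k > x / (2 n)] and [4 n ^ 2 <= x], so its weight is at least
    [(ln x / 2) (n / x)]. *)
Lemma window_sum (e : R) n x : 0 < e <= 1 / 2 -> 6 / e <= n%:R -> (4 * n ^ 2 <= x)%N ->
  e / 4 * ln x%:R <= \sum_(1 <= k < x.+1) (ln k%:R / k%:R) *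
     ((n <= x %/ k)%N && ((x %/ k)%:R <= (1 + e) * n%:R))%:R.
Proof.
move=> /andP[e0 e1] en nx.
have N0 : (0 : R) < n%:R by apply: lt_le_trans en; rewrite divr_gt0.
have n0 : (0 < n)%N by rewrite -(ltr0n R).
have X4 : 4 * n%:R ^+ 2 <= x%:R :> R by rewrite -natrX -natrM ler_nat.
have X0 : (0 : R) < x%:R by apply: lt_le_trans X4; rewrite mulr_gt0 // exprn_gt0.
have Lx : 0 <= ln (x%:R : R) by exact: ln_nat_ge0.
have D0 : 0 < (1 + e) * n%:R by rewrite mulr_gt0 //; lra.
set z : R := x%:R / ((1 + e) * n%:R).
have z0 : 0 <= z by rewrite divr_ge0 // ltW.
set k0 := Num.truncn z; set k1 := (x %/ n)%N.
have k0z : k0%:R <= z by rewrite truncn_le.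
have zk0 : z < k0.+1%:R by exact: truncnS_gt.
have k1x : x%:R / n%:R < k1%:R + 1 :> R by exact: natr_divn_gt.
apply: (@le_trans _ _ (\sum_(k0.+1 <= k < k1.+1) (ln k%:R / k%:R) *
     ((n <= x %/ k)%N && ((x %/ k)%:R <= (1 + e) * n%:R))%:R)); last first.
  apply: ler_sum_subrange => // [k|]; last by rewrite ltnS leq_div.
  by rewrite mulr_ge0 // divr_ge0 // ln_nat_ge0.
apply: (@le_trans _ _ (\sum_(k0.+1 <= k < k1.+1) (ln x%:R / 2 * (n%:R / x%:R)))).
  rewrite sumr_const_nat subSS -[leRHS]mulr_natl.
  have h : k1%:R - k0%:R <= (k1 - k0)%:R :> R.
    by rewrite lerBlDr -natrD ler_nat addnC -leq_subLR.
  have -> : e / 4 * ln x%:R = e / 2 * (x%:R / n%:R) * (ln x%:R / 2 * (n%:R / x%:R)).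
    by field; rewrite !gt_eqF.
  apply: ler_wpM2r; first by rewrite mulr_ge0 // divr_ge0.
  apply: le_trans h.
  have zE : z * (1 + e) = x%:R / n%:R.
    by rewrite /z; field; rewrite !gt_eqF //; lra.
  have w : 24 / e <= x%:R / n%:R.
    rewrite ler_pdivlMr //; apply: le_trans X4; rewrite expr2 mulrA ler_wpM2r ?(ltW N0) //.
    by lra.
  rewrite -zE in w k1x *.
  have w' : 24 <= z * (1 + e) * e by rewrite -ler_pdivrMr.
  have : z * e * e <= z * e * (1 / 2) by rewrite ler_wpM2l // mulr_ge0 // ltW.
  lra.
apply: ler_sum_nat => k /andP[k0k kk1].
have kpos : (0 < k)%N by exact: leq_trans k0k.
have K0 : (0 : R) < k%:R by rewrite ltr0n.
have zk : z < k%:R by apply: lt_le_trans zk0 _; rewrite ler_nat.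
have kn : (k * n <= x)%N by rewrite -leq_divRL.
have kn' : k%:R * n%:R <= x%:R :> R by rewrite -natrM ler_nat.
have xk : x%:R < k%:R * ((1 + e) * n%:R) :> R by rewrite -ltr_pdivrMr.
have -> : (n <= x %/ k)%N by rewrite leq_divRL // mulnC.
have -> : (x %/ k)%:R <= (1 + e) * n%:R.
  apply: le_trans (@natr_divn_le R x k) _; rewrite ler_pdivrMr //; apply: ltW.
  by rewrite mulrC.
rewrite mulr1.
apply: ler_pM; rewrite ?divr_ge0 ?(ltW N0) ?(ltW X0) //; last first.
  by rewrite ler_pdivrMr // mulrC ler_pdivlMr // mulrC.
rewrite ler_pdivrMr // mulr_natr -lnXn // ler_ln ?posrE ?exprn_gt0 //.
have xk2 : x%:R <= 2 * n%:R * k%:R :> R.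
  apply: le_trans (ltW xk) _; rewrite mulrC ler_wpM2r ?(ltW K0) // ler_wpM2r ?(ltW N0) //; lra.
have : x%:R * x%:R <= (2 * n%:R * k%:R) * (2 * n%:R * k%:R) :> R.
  by apply: ler_pM => //; exact: ltW.
have -> : (2 * n%:R * k%:R) * (2 * n%:R * k%:R) = (4 * n%:R ^+ 2) * k%:R ^+ 2 :> R by ring.
have : (4 * n%:R ^+ 2) * k%:R ^+ 2 <= x%:R * k%:R ^+ 2 :> R by rewrite ler_wpM2r // sqr_ge0.
by move=> h1 h2; rewrite -(ler_pM2l X0); exact: le_trans h2 h1.
Qed.

(** The extra [ln x / 2] absorbs the squares of the increments [D <= 1] of [ln]. *)
Lemma sum_ln_div x :
  \sum_(1 <= k < x.+1) ln k%:R / k%:R <= ln x%:R ^+ 2 / 2 + ln x%:R / 2 :> R.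
Proof.
elim: x => [|x IH]; first by rewrite big_geq // ln0 // expr0n !mul0r addr0.
rewrite big_nat_recr //=.
have [->|x0] := posnP x; first by rewrite big_geq // ln1 expr0n !mul0r addr0.
have h1 := @ln_succ_ge R x x0; have h2 := @ln_succ_le R x x0.
have i1 : x%:R^-1 <= 1 :> R by rewrite invf_le1 ?ler1n ?ltr0n.
have l1 := @ln_nat_ge0 R x.+1; have l0 := @ln_nat_ge0 R x.
set D : R := ln x.+1%:R - ln x%:R in h1 h2.
have D0 : 0 <= D by apply: le_trans h1; rewrite invr_ge0.
have : ln x.+1%:R / x.+1%:R <= ln x.+1%:R * D by rewrite ler_wpM2l.
have : D * D <= D * 1 by rewrite ler_wpM2l //; lra.
move: IH; have -> : ln x%:R = ln x.+1%:R - D by rewrite /D; ring.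
set L := ln x.+1%:R; set S := \sum_(_ <= _ < _) _.
set q := L / _; lra.
Qed.

End GoodIntervals.

(** * The prime number theorem *)

Section Improvement.
Context {R : realType}.
Implicit Types (n m x k d : nat).
Local Notation psi_err := (@psi_err R).

Lemma sum_exclusive (p : pred nat) J :
  (forall i j, (i < j)%N -> p i -> ~~ p j) ->
  \sum_(0 <= j < J) (p j)%:R = (has p (iota 0 J))%:R :> R.
Proof.
move=> ex; elim: J => [|J IH]; first by rewrite big_geq.
have -> : iota 0 J.+1 = iota 0 J ++ [:: J] by rewrite -[J.+1]addn1 iotaD.
rewrite big_nat_recr //= IH has_cat /= orbF.
have [/hasP[i]|_] := boolP (has p _); last by rewrite add0r.
by rewrite mem_iota => /andP[_ iJ] pi; rewrite (negbTE (ex _ _ iJ pi)) addr0.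
Qed.

(** Inserting [a x / k + C] in [selberg_bound] gives back [a x ln^2 x]. On disjoint windows from
    [rem_small_interval] the bound [d / 2] replaces [a >= d], and they carry a fixed proportion of
    the sum of [ln k / k]. *)
Lemma rem_improve (d : R) : 0 < d <= 1 -> exists2 c, 0 < c &
  forall a K0, d <= a -> 0 <= K0 -> (forall x, `|psi_err x| <= a * x%:R + K0) ->
  exists2 K1, 0 <= K1 & forall x, `|psi_err x| <= (a - c) * x%:R + K1.
Proof.
move=> /andP[d0 d1]; pose e := d / 6.
have e0 : 0 < e by rewrite /e; lra.
have e1 : e <= 1 / 2 by rewrite /e; lra.
have [K K0 [Y1 Y10 HY1]] := @rem_small_interval R e ltac:(by rewrite e0 e1).
have [Y2 Y20 HY2] := @natr_unbounded R (6 / e).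
have /choice[f Hf] : forall y, exists n, (Y1 <= y)%N -> (y <= n <= K * y)%N /\
    forall m, (n <= m)%N -> m%:R <= (1 + e) * n%:R -> `|psi_err m| <= 3 * e * m%:R.
  move=> y; have [yY|yY] := leqP Y1 y; last by exists 0%N.
  by have [n Hn] := HY1 y yY; exists n.
(* The window [[N j, (1 + e) N j]] has [y j <= N j <= K * y j], hence ends below
   [2 K * y j = y j.+1]: ratio [L] makes the windows disjoint. *)
pose Y := maxn Y1 Y2; pose L := (2 * K)%N.
have L2 : (1 < L)%N by rewrite /L; lia.
pose lnL := ln (L%:R : R).
have lnL0 : 0 < lnL by rewrite ln_gt0 // ltr1n.
(* The saving [d / 2] times the proportion [e / (32 lnL)] found in [GS]; it does not depend on
   [a]. *)
pose c := d * e / (64 * lnL).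
have c0 : 0 < c by rewrite divr_gt0 ?mulr_gt0.
have YY1 : (Y1 <= Y)%N by rewrite leq_maxl.
have YY2 : (Y2 <= Y)%N by rewrite leq_maxr.
have Y0 : (0 < Y)%N by exact: leq_trans YY1.
pose y j := (Y * L ^ j)%N; pose N j := f (y j).
have yY j : (Y <= y j)%N by rewrite leq_pmulr // expn_gt0 (ltnW L2).
have yS j : (2 * (K * y j) = y j.+1)%N.
  by rewrite /y /L expnS (mulnCA K) (mulnCA 2) -(mulnA 2 K).
have HN j : (y j <= N j <= K * y j)%N /\ forall m, (N j <= m)%N ->
    m%:R <= (1 + e) * (N j)%:R -> `|psi_err m| <= 3 * e * m%:R.
  by apply: Hf; exact: leq_trans (yY j).
exists c => // a C da C0 HC.
have a0 : 0 < a by exact: lt_le_trans da.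
(* The terms serve in turn the lower bound [J2], the condition [4 * N j ^ 2 <= x], the estimate
   [big], and [1 <= l]. *)
pose B := 8 * lnL + 2 * ln (4 * Y ^ 2)%:R + (a + 2 * C + 400) / c + 1.
have [X X0 HX] := @ln_unbounded R B.
have K10 : 0 <= (9 + c) * X%:R by rewrite mulr_ge0 //; lra.
exists ((9 + c) * X%:R) => // x.
have [xX|xX] := ltnP x X.
  have := @normr_rem_le R x; have : x%:R <= X%:R :> R by rewrite ler_nat ltnW.
  move=> h1 h2.
  have h3 : 0 <= a * x%:R by rewrite mulr_ge0 // ltW.
  have : (9 + c) * x%:R <= (9 + c) * X%:R by rewrite ler_wpM2l //; lra.
  by move=> *; lra.
suff : `|psi_err x| <= (a - c) * x%:R by move=> *; lra.
have x0 : (0 < x)%N by exact: leq_trans xX.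
have xr0 : (0 : R) < x%:R by rewrite ltr0n.
have lnY0 : 0 <= ln ((4 * Y ^ 2)%:R : R) by exact: ln_nat_ge0.
have E0 : 0 <= (a + 2 * C + 400) / c by apply: divr_ge0; lra.
have HB := HX x xX; rewrite /B in HB.
set l := ln (x%:R : R) in HB.
have l1 : 1 <= l by lra.
(* [L ^ J] is at most [x ^ (1 / 4)], low enough for [window_sum], while [J] is still proportional to
   [l]. *)
pose J := Num.truncn (l / (4 * lnL)).
have L40 : 0 < 4 * lnL by rewrite mulr_gt0.
have J1 : J%:R * lnL <= l / 4.
  have : J%:R <= l / (4 * lnL) by rewrite truncn_le // divr_ge0 // ?ltW //; lra.
  by rewrite ler_pdivlMr //; lra.
have J2 : l / 8 <= J%:R * lnL.
  have : l / (4 * lnL) < J.+1%:R by exact: truncnS_gt.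
  by rewrite ltr_pdivrMr // -natr1; lra.
have small j : (j < J)%N -> (4 * N j ^ 2 <= x)%N.
  move=> jJ; have [/andP[_ h] _] := HN j.
  have h1 : (N j <= Y * L ^ J)%N.
    apply: leq_trans h _; apply: (@leq_trans (y j.+1)); first by rewrite -yS leq_pmull.
    by rewrite leq_mul2l leq_exp2l // jJ orbT.
  apply: (@leq_trans (4 * Y ^ 2 * L ^ (2 * J))%N).
    by rewrite -mulnA (mulnC 2%N J) expnM -expnMn leq_mul2l leq_sqr.
  rewrite -(ler_nat R) -ler_ln ?posrE ?ltr0n //; last first.
    by rewrite !muln_gt0 !expn_gt0 Y0 (ltnW L2).
  rewrite ln_natM ?muln_gt0 ?expn_gt0 ?Y0 ?(ltnW L2) //.
  rewrite [X in _ + ln X]natrX lnXn ?ltr0n ?(ltnW L2) //.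
  rewrite -[ln _ *+ _]mulr_natl [(2 * J)%:R]natrM -/lnL -/l.
  by lra.
pose g j k := (N j <= x %/ k)%N && ((x %/ k)%:R <= (1 + e) * (N j)%:R).
have gex k i j : (i < j)%N -> g i k -> ~~ g j k.
  move=> ij /andP[h1 h2]; apply/negP => /andP[h3 _].
  have [/andP[_ Ni] _] := HN i; have [/andP[Nj _] _] := HN j.
  have i0 : (0 < N i)%N.
    by have [/andP[+ _] _] := HN i; apply: leq_trans; apply: leq_trans (yY i).
  have : (x %/ k < 2 * N i)%N.
    rewrite -(ltr_nat R) natrM; apply: le_lt_trans h2 _.
    by rewrite ltr_pM2r ?ltr0n //; lra.
  have : (2 * N i <= y i.+1)%N by rewrite -yS leq_mul2l.
  have : (y i.+1 <= y j)%N by rewrite leq_mul2l leq_exp2l // ij orbT.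
  by move=> h4 h5; rewrite ltnNge (leq_trans h5) // (leq_trans h4) // (leq_trans Nj).
pose G k : R := \sum_(0 <= j < J) (g j k)%:R.
have pw k : (0 < k <= x)%N ->
    `|psi_err (x %/ k)| <= a * (x%:R / k%:R) + C - d / 2 * (x%:R / k%:R) * G k.
  move=> /andP[k0 kx].
  have q0 : 0 <= x%:R / k%:R :> R by rewrite divr_ge0.
  have qx : (x %/ k)%:R <= x%:R / k%:R :> R by exact: natr_divn_le.
  rewrite /G sum_exclusive; last by move=> i j; exact: gex.
  have [/hasP[j _ /andP[gj1 gj2]]|_] := boolP (has _ _).
    rewrite mulr1; have [_ /(_ _ gj1 gj2)] := HN j.
    have -> : 3 * e = d / 2 by rewrite /e; field.
    have : d / 2 * (x %/ k)%:R <= d / 2 * (x%:R / k%:R) by rewrite ler_wpM2l //; lra.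
    have : d * (x%:R / k%:R) <= a * (x%:R / k%:R) by rewrite ler_wpM2r.
    by move=> *; lra.
  rewrite mulr0 subr0; apply: le_trans (HC _) _.
  by rewrite lerD2r ler_wpM2l // ltW.
have GS : e / 32 * l ^+ 2 / lnL <= \sum_(1 <= k < x.+1) ln k%:R / k%:R * G k.
  rewrite /G; under [leRHS]eq_bigr do rewrite mulr_sumr.
  rewrite exchange_big /=.
  apply: (@le_trans _ _ (\sum_(0 <= j < J) e / 4 * l)).
    rewrite sumr_const_nat subn0 -[leRHS]mulr_natl ler_pdivrMr //.
    have : l / 8 * (e / 4 * l) <= J%:R * lnL * (e / 4 * l).
      by rewrite ler_wpM2r // mulr_ge0 //; lra.
    by lra.
  apply: ler_sum_nat => j /andP[_ jJ]; apply: window_sum; rewrite ?e0 ?e1 ?small //.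
  apply: HY2; apply: leq_trans YY2 _; apply: leq_trans (yY j) _.
  by have [/andP[]] := HN j.
have l20 : 0 < l ^+ 2 by rewrite exprn_gt0 //; lra.
rewrite -(ler_pM2r l20); apply: le_trans (selberg_bound x) _.
rewrite -/l.
have S1 : \sum_(1 <= k < x.+1) ln k%:R * `|psi_err (x %/ k)| <=
    a * x%:R * (l ^+ 2 / 2 + l / 2) + C * (x%:R * l) - d / 2 * x%:R * (e / 32 * l ^+ 2 / lnL).
  apply: (@le_trans _ _ (a * x%:R * (\sum_(1 <= k < x.+1) ln k%:R / k%:R) +
     C * lnfact x - d / 2 * x%:R * \sum_(1 <= k < x.+1) ln k%:R / k%:R * G k)).
    rewrite /lnfact !mulr_sumr -big_split -sumrB /=; apply: ler_sum_nat => k k1.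
    have := pw k k1 => h; apply: le_trans (ler_wpM2l (ln_nat_ge0 _) h) _.
    by rewrite le_eqVlt; apply/orP; left; apply/eqP; ring.
  apply: lerB; last by rewrite ler_wpM2l // !mulr_ge0 //; lra.
  apply: lerD; last by rewrite ler_wpM2l // lnfact_le.
  by rewrite ler_wpM2l ?sum_ln_div // mulr_ge0 // ltW.
have cE : d / 2 * x%:R * (e / 32 * l ^+ 2 / lnL) = c * x%:R * l ^+ 2.
  by rewrite /c; field; rewrite gt_eqF.
rewrite cE in S1.
have xl : x%:R <= x%:R * l by rewrite ler_peMr // ltW.
(* [selberg_bound] doubles the saving to [2 c x l ^ 2]: one half lowers [a] by [c], the other pays
   for the terms of order [x l]. *)
have big : (a + 2 * C + 400) * (x%:R * l) <= c * x%:R * l ^+ 2.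
  have : (a + 2 * C + 400) / c <= l by lra.
  rewrite ler_pdivrMr // => h.
  have -> : c * x%:R * l ^+ 2 = l * c * (x%:R * l) by ring.
  by rewrite ler_wpM2r // mulr_ge0 // ltW //; lra.
lra.
Qed.

(** The gain [c] of [rem_improve] depends on [d] only, so about [9 / c] steps bring the coefficient
    from 9 to [d], where [Num.max] holds it. *)
Lemma prime_number_theorem_psi (d : R) : 0 < d ->
  exists2 C, 0 <= C & forall x, `|psi_err x| <= d * x%:R + C.
Proof.
wlog d1 : d / d <= 1.
  move=> W d0; have [d1|d1] := leP d 1; first exact: W.
  have [|//|C C0 HC] := W 1; first by [].
  exists C => // x; apply: le_trans (HC x) _.
  by rewrite lerD2r ler_wpM2r // ltW.
move=> d0; have [c c0 Hc] := @rem_improve d ltac:(by rewrite d0 d1).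
have iter i : exists2 C, 0 <= C & forall x, `|psi_err x| <= Num.max d (9 - i%:R * c) * x%:R + C.
  elim: i => [|i [C C0 HC]].
    exists 0 => // x; rewrite mul0r subr0 addr0; apply: le_trans (normr_rem_le x) _.
    by rewrite ler_wpM2r // le_max lexx orbT.
  have [|K1 K10 HK] := Hc (Num.max d (9 - i%:R * c)) C _ C0 HC.
    by rewrite le_max lexx.
  exists K1 => // x; apply: le_trans (HK x) _.
  rewrite lerD2r ler_wpM2r // -(natr1 i).
  have [h|h] := leP d (9 - i%:R * c); rewrite le_max; apply/orP; [right|left]; lra.
have [i _ Hi] := @natr_unbounded R (9 / c).
have [C C0 HC] := iter i; exists C => // x.
apply: le_trans (HC x) _; rewrite max_l //.
by have := Hi i (leqnn i); rewrite ler_pdivrMr //; lra.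
Qed.

End Improvement.

(** * From [psi] to the prime counting function *)

Section PrimeCounting.
Context {R : realType}.
Implicit Types (n m x k d : nat).
Local Notation psi_err := (@psi_err R).
Local Notation psi := (@psi R).
Local Notation mangoldt := (@mangoldt R).

Lemma prime_piS n : prime_pi n.+1 = (prime_pi n + prime n.+1)%N.
Proof. by rewrite /prime_pi big_nat_recr. Qed.

Lemma prime_pi_le n : (prime_pi n <= n)%N.
Proof.
elim: n => [|n IH]; first by rewrite /prime_pi big_geq.
by rewrite prime_piS -[n.+1]addn1 leq_add // leq_b1.
Qed.

Lemma ler_prime_pi m n : (m <= n)%N -> (prime_pi m <= prime_pi n)%N.
Proof.
elim: n => [|n IH]; first by rewrite leqn0 => /eqP ->.
rewrite leq_eqVlt => /orP[/eqP -> //|]; rewrite ltnS => /IH h.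
by rewrite prime_piS (leq_trans h) ?leq_addr.
Qed.

(** The exponent counts the positive powers of [p] up to [x + 1]. When [x + 2 = p ^ e.+1], the
    induction hypothesis bounds the earlier count by [e]. *)
Lemma expn_count_prime_powers p x : prime p ->
  (p ^ (\sum_(1 <= n < x.+2) (primes n == [:: p])) <= x.+1)%N.
Proof.
move=> pp; elim: x => [|x IH]; first by rewrite big_nat1.
rewrite big_nat_recr //=; case: eqP => [px|_]; last by rewrite addn0 ltnW.
have /(@mangoldt_neq0P R)[q [e [pq xE]]] : mangoldt x.+2 != 0.
  by rewrite /mangoldt px gt_eqF // ln_gt0 // ltr1n prime_gt1.
have qp : q = p by move: px; rewrite xE primesX // primes_prime // => -[].
move: IH; set S := (\sum_(_ <= _ < _) _)%N => IH.
have : (p ^ S < p ^ e.+1)%N by rewrite -qp -xE qp ltnS.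
by rewrite addn1 xE qp ltn_exp2l ?prime_gt1 // leq_exp2l ?prime_gt1.
Qed.

(** Grouped by prime, the powers of [p] contribute the logarithm of a power of [p] that is at most
    [x]. *)
Lemma psi_le_prime_pi x : psi x <= (prime_pi x)%:R * ln x%:R.
Proof.
case: x => [|x]; first by rewrite psi0 ln0 // mulr0.
have -> : psi x.+1 = \sum_(1 <= p < x.+2)
    (\sum_(1 <= n < x.+2) (primes n == [:: p])%:R) * ln p%:R.
  transitivity (\sum_(1 <= n < x.+2) \sum_(1 <= p < x.+2)
      (primes n == [:: p])%:R * ln p%:R : R);
    last by rewrite exchange_big; apply: eq_bigr => p _; rewrite mulr_suml.
  apply: eq_big_nat => n /andP[n0 nx]; rewrite /mangoldt.
  case E: (primes n) => [|p [|q s]].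
  - by rewrite big1 // => p _; rewrite mul0r.
  - have : p \in primes n by rewrite E mem_head.
    rewrite mem_primes => /and3P[pp _ pn].
    rewrite (bigD1_seq p) ?iota_uniq //=; last first.
      by rewrite mem_index_iota prime_gt0 //= ltnS (leq_trans (dvdn_leq n0 pn)).
    rewrite eqxx mul1r big1 ?addr0 // => q qp.
    by rewrite eqseq_cons andbT eq_sym (negbTE qp) mul0r.
  - by rewrite big1 // => r _; rewrite eqseq_cons andbF mul0r.
rewrite /prime_pi natr_sum mulr_suml; apply: ler_sum_nat => p /andP[p0 px].
rewrite -natr_sum; case pp: (prime p); last first.
  rewrite mul0r big1_seq ?mul0r // => n _.
  by case: eqP => // E; move: (mem_head p [::]); rewrite -E mem_primes pp.
rewrite mul1r mulr_natl -lnXn ?ltr0n // ler_ln ?posrE ?exprn_gt0 ?ltr0n //.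
by rewrite -natrX ler_nat expn_count_prime_powers.
Qed.

(** Each prime above [y] contributes at least [ln y] to [psi x]; at most [y] primes are left. *)
Lemma prime_pi_le_psi x y : (0 < y)%N ->
  (prime_pi x)%:R * ln y%:R <= psi x + y%:R * ln y%:R.
Proof.
move=> y0; have L0 := @ln_nat_ge0 R y.
elim: x => [|x IH].
  by rewrite /prime_pi big_geq // mul0r psi0 add0r mulr_ge0.
have [xy|yx] := leqP x.+1 y.
  apply: (@le_trans _ _ (y%:R * ln y%:R)); last by rewrite lerDr psi_ge0.
  by rewrite ler_wpM2r // ler_nat (leq_trans (prime_pi_le _)).
rewrite prime_piS natrD mulrDl psiS.
suff : (prime x.+1)%:R * ln y%:R <= mangoldt x.+1 by lra.
case pp: (prime x.+1); last by rewrite mul0r mangoldt_ge0.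
by rewrite mul1r /mangoldt primes_prime // ler_ln_nat // ltnW.
Qed.

(** Take [y] about [x ^ (1 - d)] in [prime_pi_le_psi]: then [ln y >= (1 - 2 d) ln x] and still
    [y ln x <= d x]. *)
Lemma prime_pi_upper (e : R) : 0 < e -> exists2 X, (0 < X)%N & forall x, (X <= x)%N ->
  (prime_pi x)%:R * ln x%:R <= (1 + e) * x%:R.
Proof.
wlog e1 : e / e <= 1.
  move=> W e0; have [e1|e1] := leP e 1; first exact: W.
  have [//|//|X X0 HX] := W 1; exists X => // x /HX h; apply: le_trans h _.
  by rewrite ler_wpM2r //; lra.
(* As [d <= 1 / 16], [1 + 3 d <= (1 - 2 d) (1 + 16 d)], which concludes. *)
move=> e0; pose d := e / 16.
have d0 : 0 < d by rewrite /d; lra.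
have [C C0 HC] := @prime_number_theorem_psi R d d0.
have [X1 X10 HX1] := @ln_unbounded R (8 / d ^+ 3 + 2 / d).
have [X2 X20 HX2] := @natr_unbounded R (C / d).
exists (maxn X1 X2); first by rewrite leq_max X10.
move=> x; rewrite geq_max => /andP[xX1 xX2].
have x0 : (0 < x)%N by exact: leq_trans xX1.
have xr0 : (0 : R) < x%:R by rewrite ltr0n.
have Cx : C <= d * x%:R by have := HX2 x xX2; rewrite ler_pdivrMr // mulrC.
have := HX1 x xX1; set l := ln (x%:R : R) => lC.
have p1 : 0 < 8 / d ^+ 3 by rewrite divr_gt0 // exprn_gt0.
have p2 : 0 < 2 / d by rewrite divr_gt0.
have l0 : 0 < l by lra.
have ld : 2 <= l * d by rewrite -ler_pdivrMr //; lra.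
have ld3 : 8 <= l * d ^+ 3 by rewrite -ler_pdivrMr ?exprn_gt0 //; lra.
have xE : expR l = x%:R by rewrite lnK // posrE.
pose z := expR ((1 - d) * l); pose y := Num.truncn z.
have z0 : 0 < z by exact: expR_gt0.
have d1 : d <= 1 / 16 by rewrite /d; lra.
have z1 : 1 <= z.
  have h : 0 <= (1 - d) * l by rewrite mulr_ge0 //; lra.
  by have := @expR_ge1Dx R ((1 - d) * l); rewrite -/z; lra.
have y0 : (0 < y)%N by rewrite truncn_gt0.
have yz : y%:R <= z by rewrite truncn_le // ltW.
have zy : z < y.+1%:R by exact: truncnS_gt.
have zx : z * expR (d * l) = x%:R.
  by rewrite /z -expRD -xE; congr expR; ring.
(* Quadratic growth of the exponential suffices: [(d l / 2) ^ 2 >= l / d] because [l d ^ 3 >= 8]. *)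
have ed : 2 * (l / d) <= expR (d * l) * 2.
  have -> : d * l = d * l / 2 + d * l / 2 by field.
  rewrite expRD; have h := @expR_ge1Dx R (d * l / 2).
  have h0 : 0 <= d * l / 2 by lra.
  have : (d * l / 2) * (d * l / 2) <= expR (d * l / 2) * expR (d * l / 2).
    by apply: ler_pM => //; lra.
  have : l / d <= (d * l / 2) * (d * l / 2).
    rewrite ler_pdivrMr //.
    have -> : d * l / 2 * (d * l / 2) * d = l * d ^+ 3 * l / 4 by field.
    have : 8 * l <= l * d ^+ 3 * l by rewrite ler_wpM2r // ltW.
    lra.
  by move=> *; lra.
have yl : y%:R * l <= d * x%:R.
  rewrite -zx mulrCA; apply: ler_pM => //; first exact: ltW.
  rewrite -ler_pdivrMl // mulrC; lra.
have ly : (1 - 2 * d) * l <= ln y%:R.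
  have : ln z <= ln (2 * y)%:R.
    rewrite ler_ln ?posrE ?ltr0n ?muln_gt0 //; apply: le_trans (ltW zy) _.
    by rewrite ler_nat mul2n -addnn -addn1 leq_add2l.
  rewrite /z expRK ln_natM //.
  have : ln (2 : R) <= 2 by have := @ln_sublinear R 2 ltac:(lra); lra.
  by move=> *; lra.
have lyl : ln y%:R <= l.
  rewrite ler_ln ?posrE ?ltr0n //; apply: le_trans yz _; rewrite -zx ler_peMr ?(ltW z0) //.
  by rewrite -expR0 ler_expR mulr_ge0 // ltW.
have := prime_pi_le_psi x y y0.
have := HC x; rewrite /psi_err ler_norml => /andP[_ h1] h2.
have h3 : y%:R * ln y%:R <= y%:R * l by rewrite ler_wpM2l.
set P : R := (prime_pi x)%:R in h2 *.
have h4 : P * ((1 - 2 * d) * l) <= P * ln y%:R by rewrite ler_wpM2l.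
have h5 : (1 - 2 * d) * (P * l) <= (1 + 3 * d) * x%:R by lra.
have q0 : 0 < 1 - 2 * d by lra.
rewrite -(ler_pM2l q0); apply: le_trans h5 _.
rewrite [leRHS]mulrA ler_wpM2r //.
have -> : e = 16 * d by rewrite /d; field.
have : d * d <= d * (1 / 16) by rewrite ler_wpM2l // ltW.
lra.
Qed.

End PrimeCounting.

(** * Asymptotics of [NP] *)

Section Counting.
Context {R : realType}.

(** By [NP_le]; the possible prime [n + 1] adds at most [ln 2 ln n], covered by half of [e]. *)
Lemma ln_NP_upper (e : R) : 0 < e -> exists2 X, (0 < X)%N & forall n, (X <= n)%N ->
  ln (NP n)%:R * ln n%:R <= (1 + e) * (ln 2 * n%:R).
Proof.
move=> e0; have [X1 X10 HX1] := @prime_pi_upper R (e / 2) ltac:(lra).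
have [X2 X20 HX2] := @natr_unbounded R (4 / (e / 2 * (e / 2))).
exists (maxn X1 X2); first by rewrite leq_max X10.
move=> n; rewrite geq_max => /andP[nX1 nX2].
have n0 : (0 < n)%N by exact: leq_trans nX1.
have N0 : (0 : R) < n%:R by rewrite ltr0n.
have ln20 : 0 < ln (2 : R) by rewrite ln_gt0 //; lra.
have l0 := @ln_nat_ge0 R n; set l : R := ln n%:R in l0 *.
have NP0 : (0 < NP n)%N.
  by apply: leq_trans (@NP_ge n n.+1 (2 * (n.+1)`!) _ _); rewrite ?expn_gt0 //;
     have := fact_gt0 n.+1; nia.
have h1 : ln (NP n)%:R <= ln 2 * (prime_pi n)%:R + ln 2 :> R.
  have : ln (NP n)%:R <= ln (2 ^ prime_pi n.+1)%:R :> R.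
    by apply: ler_ln_nat => //; exact: NP_le.
  rewrite natrX lnXn // -[ln 2 *+ _]mulr_natr prime_piS natrD mulrDr => h.
  apply: le_trans h _; rewrite lerD2l ler_piMr ?(ltW ln20) // lern1 leq_b1 //.
have h2 := HX1 n nX1; rewrite -/l in h2.
have h3 : l <= e / 2 * n%:R.
  have := HX2 n nX2; rewrite ler_pdivrMr ?mulr_gt0 //; try lra.
  (* [s] is the square root of [n], and [ln n <= 2 s]. *)
  pose s := expR (l / 2); have sE : s * s = n%:R.
    by rewrite /s -expRD -[RHS]lnK ?posrE // -/l; congr expR; field.
  have s0 : 0 < s by exact: expR_gt0.
  have sl : l <= 2 * s by have := @expR_ge1Dx R (l / 2); rewrite -/s; lra.
  rewrite -sE => hs.
  have es : 2 <= e / 2 * s.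
    have es0 : 0 <= e / 2 * s by rewrite mulr_ge0 // ltW //; lra.
    rewrite leNgt; apply/negP => es2.
    have : e / 2 * s * (e / 2 * s) < 2 * 2 by apply: ltr_pM.
    lra.
  apply: le_trans sl _; rewrite mulrA ler_wpM2r // ltW //.
have h4 : ln (NP n)%:R * l <= (ln 2 * (prime_pi n)%:R + ln 2) * l by rewrite ler_wpM2r.
have h5 : ln 2 * ((prime_pi n)%:R * l) <= ln 2 * ((1 + e / 2) * n%:R).
  by rewrite ler_wpM2l // ltW.
have h6 : ln 2 * l <= ln 2 * (e / 2 * n%:R) by rewrite ler_wpM2l // ltW.
lra.
Qed.

(** [NP_ge] with [B] about [d n]. In units of [n / ln n], the primes up to [B] cost at most [4 d]
    and the passage from [psi] costs [2 d], within [e = 8 d]. *)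
Lemma ln_NP_lower (e : R) : 0 < e -> exists2 X, (0 < X)%N & forall n, (X <= n)%N ->
  (1 - e) * (ln 2 * n%:R) <= ln (NP n)%:R * ln n%:R.
Proof.
wlog e1 : e / e <= 1.
  move=> W e0; have [e1|e1] := leP e 1; first exact: W.
  have [//|//|X X0 HX] := W 1; exists X => // n /HX h; apply: le_trans h.
  by rewrite ler_wpM2r // ?mulr_ge0 ?ln_ge0 //; lra.
move=> e0; pose d := e / 8; have d0 : 0 < d by rewrite /d; lra.
have [C C0 HC] := @prime_number_theorem_psi R d d0.
have [X1 X10 HX1] := @prime_pi_upper R 1 ltac:(lra).
pose L := (Num.truncn (4 / d)).+1.
have Ld : 4 <= L%:R * d by rewrite -ler_pdivrMr //; apply/ltW; exact: truncnS_gt.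
(* The summands ensure in turn [C <= d n], [2 (n + 1) <= L B], [2 L! <= B] and [X1 <= B]. *)
have [X2 X20 HX2] := @natr_unbounded R
  (C / d + (L%:R + 2) + ((2 * L`!)%:R + 1) / d + (X1%:R + 1) / d).
(* This gives [ln B >= ln n / 2], as [B >= n d / 2]. *)
have [X3 X30 HX3] := @ln_unbounded R (2 * ln (2 / d) + 1).
exists (maxn X2 X3); first by rewrite leq_max X20.
move=> n; rewrite geq_max => /andP[nX2 nX3].
have n0 : (0 < n)%N by exact: leq_trans nX2.
have N0 : (0 : R) < n%:R by rewrite ltr0n.
have := HX2 n nX2.
have q1 : 0 <= C / d by rewrite divr_ge0 // ltW.
have q2 : 0 <= ((2 * L`!)%:R + 1) / d by rewrite divr_ge0 ?(ltW d0) // addr_ge0.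
have q3 : 0 <= (X1%:R + 1) / d by rewrite divr_ge0 ?(ltW d0) // addr_ge0.
have q4 : 0 <= L%:R :> R by [].
move=> hn.
have a1 : C <= n%:R * d by rewrite -ler_pdivrMr //; lra.
have a2 : L%:R + 2 <= n%:R :> R by lra.
have a3 : (2 * L`!)%:R + 1 <= n%:R * d by rewrite -ler_pdivrMr //; lra.
have a4 : X1%:R + 1 <= n%:R * d by rewrite -ler_pdivrMr //; lra.
have ln20 : 0 < ln (2 : R) by rewrite ln_gt0 //; lra.
have := HX3 n nX3.
set l : R := ln n%:R => l1.
have ld0 : 0 <= ln (2 / d).
  by apply: ln_ge0; rewrite ler_pdivlMr // mul1r /d; lra.
have l0 : 0 < l by lra.
pose B := Num.truncn (n%:R * d).
have B1 : B%:R <= n%:R * d by rewrite truncn_le // mulr_ge0 // ltW.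
have B2 : n%:R * d < B%:R + 1 by rewrite natr1; exact: truncnS_gt.
have NPge : (2 ^ (prime_pi n.+1 - prime_pi B) <= NP n)%N.
  apply: (@NP_ge n L B).
    by rewrite -ltnS -(ltr_nat R) -natr1; lra.
  rewrite -(ler_nat R) !natrM -natr1.
  have : L%:R * (n%:R * d) <= L%:R * (B%:R + 1) by rewrite ler_wpM2l // ltW.
  have : 4 * n%:R <= L%:R * d * n%:R by rewrite ler_wpM2r.
  lra.
have XB : (X1 <= B)%N by rewrite -ltnS -(ltr_nat R) -natr1; lra.
have B0 : (0 < B)%N by exact: leq_trans XB.
have lB : l / 2 <= ln B%:R.
  have : ln (n%:R * (d / 2)) <= ln B%:R :> R.
    rewrite ler_ln ?posrE ?ltr0n ?mulr_gt0 //; try lra.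
    have : (1 : R) <= B%:R by rewrite ler1n.
    lra.
  have -> : d / 2 = (2 / d)^-1 by rewrite invf_div.
  rewrite ln_div ?posrE ?divr_gt0 // -/l.
  by move=> *; lra.
have pB : (prime_pi B)%:R * l <= 4 * (d * n%:R).
  have := HX1 B XB.
  have : (prime_pi B)%:R * (l / 2) <= (prime_pi B)%:R * ln B%:R :> R by rewrite ler_wpM2l.
  by move=> *; lra.
have pn : (1 - 2 * d) * n%:R <= (prime_pi n)%:R * l.
  have := @psi_le_prime_pi R n; have := HC n; rewrite /psi_err ler_norml -/l => /andP[h _] h'.
  by lra.
have h1 : ln 2 * ((prime_pi n)%:R - (prime_pi B)%:R) <= ln (NP n)%:R :> R.
  have : ln (2 ^ (prime_pi n.+1 - prime_pi B))%:R <= ln (NP n)%:R :> R.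
    by apply: ler_ln_nat => //; rewrite expn_gt0.
  rewrite natrX lnXn // -[ln 2 *+ _]mulr_natr; apply: le_trans.
  rewrite ler_wpM2l ?(ltW ln20) // lerBlDr -natrD ler_nat.
  by rewrite (leq_trans (ler_prime_pi _ _ (leqnSn n))) // addnC -leq_subLR.
have h2 : ln 2 * ((prime_pi n)%:R - (prime_pi B)%:R) * l <= ln (NP n)%:R * l.
  by rewrite ler_wpM2r // ltW.
apply: le_trans h2; rewrite mulrCA -mulrA ler_wpM2l ?(ltW ln20) //.
have : e * n%:R = 8 * (d * n%:R) by rewrite /d; field.
have : 0 <= d * n%:R by rewrite mulr_ge0 // ltW.
lra.
Qed.

End Counting.

Theorem theorem14 (R : realType) :
  (fun n : nat => ln ((NP n)%:R : R)) ~_\oo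
  (fun n : nat => ln (2 : R) * (n%:R / ln (n%:R : R))).
Proof.
(* The equivalence means [|f - g| <= e |g|] eventually, for every [e > 0]. *)
apply/eqaddoP => e e0.
have [X1 X10 HX1] := ln_NP_upper e e0; have [X2 X20 HX2] := ln_NP_lower e e0.
exists (maxn 2 (maxn X1 X2)) => // n /=; rewrite !geq_max => /and3P[n2 nX1 nX2].
have l0 : 0 < ln (n%:R : R) by rewrite ln_gt0 // ltr1n.
have g0 : 0 <= ln (2 : R) * (n%:R / ln n%:R).
  by rewrite mulr_ge0 ?divr_ge0 ?(ltW l0) // ln_ge0 //; lra.
have gE : ln (2 : R) * (n%:R / ln n%:R) * ln n%:R = ln 2 * n%:R.
  by field; rewrite gt_eqF.
have h1 : ln (NP n)%:R <= (1 + e) * (ln (2 : R) * (n%:R / ln n%:R)).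
  by rewrite -(ler_pM2r l0) -mulrA gE; exact: HX1.
have h2 : (1 - e) * (ln (2 : R) * (n%:R / ln n%:R)) <= ln (NP n)%:R.
  by rewrite -(ler_pM2r l0) -mulrA gE; exact: HX2.
rewrite (ger0_norm g0) ler_norml.
move: h1 h2 {g0 gE}; set g := ln 2 * _; set f := ln _ => h1 h2.
by rewrite -[X in _ <= X <= _]/(f - g); apply/andP; split; lra.
Qed.
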